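(* Let $0\le r<q$, and suppose $\Sigma_0\succeq0$ has rank $s\le r$. Under the LAN assumption and the local set convergence and localisation assumption (both stated in the context), as $n\to\infty$ under $\Pr_{\theta_0}$, $$\Lambda_n\Rightarrow \Delta_{s,r}(P_s):=\operatorname{dist}_F^2(Y,\mathcal D_{P_s,m_s})-\operatorname{dist}_F^2(Y,\mathcal C_{P_s}),$$ where $Y$ is a standard Gaussian element of $\mathbb S^{k_s}$. Moreover, the law of $\Delta_{s,r}(P_s)$ does not depend on the selected orthonormal basis (the columns of $U_s$) of $K_s=\ker(\Sigma_0)$.
   Context: Spaces. $\mathbb S^d$ is the space of real symmetric $d\times d$ matrices with Frobenius inner product $\langle A,B\rangle_F=\operatorname{tr}(AB)$ and norm $\|\cdot\|_F$; $\mathbb S_+^d$ is its positive-semidefinite cone. $\mathcal E=\mathbb R^{d_\psi}\oplus\mathbb S^q$ with inner product $\langle(a,A),(b,B)\rangle=a^\top b+\langle A,B\rangle_F$. For a nonempty closed set $A$, $\operatorname{dist}_F(X,A)=\inf_{Z\in A}\|X-Z\|_F$. A standard Gaussian element of $\mathbb S^d$ has independent $N(0,1)$ coordinates in the Frobenius-orthonormal basis $E_{ii}$, $F_{ij}=(E_{ij}+E_{ji})/\sqrt2$, $i<j$. Experiment. The parameter is $\theta=(\psi,\Sigma)\in\mathcal E$, with $\psi$ a nuisance parameter; $\Pr_\theta$ is the law of the data and $\ell_n(\theta)$ the sample log-likelihood at sample size $n$. The model admits a regular local extension to an open neighbourhood of the true parameter $\theta_0=(\psi_0,\Sigma_0)$.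 The null and alternative parameter sets $\Theta_0\subseteq\Theta_1$ have the following restrictions on the matrix component: $\Sigma\succeq0$ and $\operatorname{rank}(\Sigma)\le r$ for $\Theta_0$; $\Sigma\succeq0$ for $\Theta_1$. The true parameter $\theta_0$ lies in $\Theta_0$. The likelihood-ratio statistic is $\Lambda_n=2\{\sup_{\theta\in\Theta_1}\ell_n(\theta)-\sup_{\theta\in\Theta_0}\ell_n(\theta)\}$. Active block. $K_s=\ker(\Sigma_0)$, $k_s=q-s$, $m_s=r-s$, $P_s$ is the orthogonal projector onto $K_s$, $U_s\in\mathbb R^{q\times k_s}$ has orthonormal columns spanning $K_s$; $\mathcal A_{P_s}(H)=U_s^\top HU_s$ and $\mathcal A_{P_s}^*(B)=U_sBU_s^\top$. For $0\le m\le k$, $\mathcal K_m^k=\{B\in\mathbb S_+^k:\operatorname{rank}(B)\le m\}$. Put $T_1(P_s)=\{H\in\mathbb S^q:\mathcal A_{P_s}(H)\succeq0\}$ and $T_{0,s}^{(r)}(P_s)=\{H\in\mathbb S^q:\mathcal A_{P_s}(H)\in\mathcal K_{m_s}^{k_s}\}$. LAN assumption. There exist random elements $Z_n\in\mathcal E$ and a self-adjoint positive-definite operator $\mathcal I$ on $\mathcal E$ such that, under $\Pr_{\theta_0}$, for every compact $C\subset\mathcal E$, $\sup_{h\in C}|\ell_n(\theta_0+n^{-1/2}h)-\ell_n(\theta_0)-\langle h,Z_n\rangle+\frac12\langle h,\mathcal Ih\rangle|\to0$ in probability, and $Z_n\Rightarrow Z\sim\mathcal N_{\mathcal E}(0,\mathcal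 I)$. Local set convergence and localisation assumption. The rescaled sets $\{h:\theta_0+n^{-1/2}h\in\Theta_0\}$ and $\{h:\theta_0+n^{-1/2}h\in\Theta_1\}$ converge on bounded sets (i.e. in Hausdorff distance after intersection with every closed bounded ball) to $\mathbb R^{d_\psi}\oplus T_{0,s}^{(r)}(P_s)$ and $\mathbb R^{d_\psi}\oplus T_1(P_s)$, respectively, and the corresponding local constrained maximisers of $h\mapsto\ell_n(\theta_0+n^{-1/2}h)$ over these rescaled sets are stochastically bounded. Reduced covariance. Partition $\mathcal I$ according to $\mathcal E=\mathbb R^{d_\psi}\oplus\mathbb S^q$ and set $\mathcal I_{\mathrm{eff}}=\mathcal I_{\Sigma\Sigma}-\mathcal I_{\Sigma\psi}\mathcal I_{\psi\psi}^{-1}\mathcal I_{\psi\Sigma}$ (positive definite on $\mathbb S^q$), $\mathcal S_{P_s}=\mathcal A_{P_s}\mathcal I_{\mathrm{eff}}^{-1}\mathcal A_{P_s}^*$ (a self-adjoint positive-definite operator on $\mathbb S^{k_s}$), $\mathcal C_{P_s}=\mathcal S_{P_s}^{-1/2}(\mathbb S_+^{k_s})$, $\mathcal D_{P_s,m_s}=\mathcal S_{P_s}^{-1/2}(\mathcal K_{m_s}^{k_s})$. *)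

(* Defs.v *)
From HB Require Import structures.
From mathcomp Require Import all_boot all_order all_algebra.
From mathcomp Require Import all_classical all_reals all_analysis.
From mathcomp Require Import ring.

Set Implicit Arguments.
Unset Strict Implicit.
Unset Printing Implicit Defensive.

Import Order.TTheory GRing.Theory Num.Theory.
Import numFieldNormedType.Exports.

Local Open Scope classical_set_scope.
Local Open Scope ring_scope.

Section inner_product_norm.
Context (R : realType) (V : lmodType R) (dot : V -> V -> R).
Hypothesis dotC : forall x y, dot x y = dot y x.
Hypothesis dotDl : forall x y z, dot (x + y) z = dot x z + dot y z.
Hypothesis dotZl : forall a x y, dot (a *: x) y = a * dot x y.
Hypothesis dot_ge0 : forall x, 0 <= dot x x.
Hypothesis dot_eq0 : forall x, dot x x = 0 -> x = 0.

Let dotDr x y z : dot x (y + z) = dot x y + dot x z.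
Proof. by rewrite dotC dotDl !(dotC x). Qed.

Let dotZr a x y : dot x (a *: y) = a * dot x y.
Proof. by rewrite dotC dotZl (dotC x). Qed.

Lemma dot_cauchy_schwarz x y : dot x y ^+ 2 <= dot x x * dot y y.
Proof.
have [y0|y0] := eqVneq (dot y y) 0.
  by rewrite (dot_eq0 y0) -(scale0r 0) dotZr mul0r expr0n dotZr mul0r mulr0.
have yp : 0 < dot y y by rewrite lt_neqAle eq_sym y0 dot_ge0.
have := dot_ge0 (dot y y *: x + (- dot x y) *: y).
rewrite !dotDl !dotDr !dotZl !dotZr (dotC y x).
have -> : dot y y * (dot y y * dot x x) + dot y y * (- dot x y * dot x y) +
   (- dot x y * (dot y y * dot x y) + - dot x y * (- dot x y * dot y y)) =
   dot y y * (dot x x * dot y y - dot x y ^+ 2).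
  by ring.
by rewrite pmulr_rge0// subr_ge0.
Qed.

Lemma dot_ler_normD x y :
  Num.sqrt (dot (x + y) (x + y)) <= Num.sqrt (dot x x) + Num.sqrt (dot y y).
Proof.
rewrite -(@ler_pXn2r _ 2)// ?nnegrE ?addr_ge0 ?sqrtr_ge0//.
rewrite sqrrD !sqr_sqrtr// dotDl !dotDr (dotC y x).
rewrite addrA lerD2r -addrA lerD2l -mulr2n lerMn2r /=.
rewrite (le_trans (ler_norm _))// -sqrtrM// -sqrtr_sqr ler_sqrt ?mulr_ge0//.
exact: dot_cauchy_schwarz.
Qed.

Lemma dot_normrZ a x :
  Num.sqrt (dot (a *: x) (a *: x)) = `|a| * Num.sqrt (dot x x).
Proof.
by rewrite dotZl dotZr mulrA -expr2 sqrtrM ?sqr_ge0// sqrtr_sqr.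
Qed.

Lemma dot_normr0_eq0 x : Num.sqrt (dot x x) = 0 -> x = 0.
Proof.
by move/eqP; rewrite sqrtr_eq0 => x0; apply/dot_eq0/le_anti; rewrite x0 dot_ge0.
Qed.

End inner_product_norm.

Section symmetric_matrices.
Context (R : realType) (q : nat).

Definition is_symmx : {pred 'M[R]_q} := fun A => A^T == A.

Fact is_symmx_submod : subsemimod_closed is_symmx.
Proof.
split; [split|].
- by rewrite unfold_in trmx0.
- by move=> A B /eqP hA /eqP hB; rewrite unfold_in linearD /= hA hB.
- by move=> a A /eqP hA; rewrite unfold_in linearZ /= hA.
Qed.

Record symM := SymM { symM_val :> 'M[R]_q ; _ : symM_val \in is_symmx }.

HB.instance Definition _ := [isSub for symM_val].
HB.instance Definition _ := [Choice of symM by <:].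
HB.instance Definition _ :=
  GRing.SubChoice_isSubLmodule.Build R 'M[R]_q is_symmx symM is_symmx_submod.

Lemma symM_tr (A : symM) : (A : 'M[R]_q)^T = A.
Proof. by apply/eqP; case: A. Qed.

Definition frob (A B : symM) : R := \tr ((A : 'M[R]_q) *m B).

Lemma frobE A B : frob A B = \sum_i \sum_j (A : 'M[R]_q) i j * (B : 'M[R]_q) i j.
Proof.
apply: eq_bigr => i _; rewrite mxE; apply: eq_bigr => j _.
by rewrite -[in LHS](symM_tr B) mxE.
Qed.

Fact frobC A B : frob A B = frob B A.
Proof. by rewrite /frob mxtrace_mulC. Qed.

Fact frobDl A B C : frob (A + B) C = frob A C + frob B C.
Proof. by rewrite /frob /= mulmxDl mxtraceD. Qed.

Fact frobZl a A B : frob (a *: A) B = a * frob A B.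
Proof. by rewrite /frob /= -scalemxAl mxtraceZ. Qed.

Fact frob_ge0 A : 0 <= frob A A.
Proof. by rewrite frobE; do 2![apply: sumr_ge0 => ? _]; rewrite -expr2 sqr_ge0. Qed.

Fact frob_eq0 A : frob A A = 0 -> A = 0.
Proof.
rewrite frobE => /eqP; rewrite psumr_eq0 => [/allP h|i _]; last first.
  by apply: sumr_ge0 => j _; rewrite -expr2 sqr_ge0.
apply/val_inj/matrixP => i j; rewrite mxE.
have /(_ (mem_index_enum _)) := h i; rewrite psumr_eq0 => [/allP hi|j' _]; last first.
  by rewrite -expr2 sqr_ge0.
by have /(_ (mem_index_enum _)) := hi j; rewrite /= mulf_eq0 orbb => /eqP.
Qed.

HB.instance Definition _ := @Lmodule_isNormed.Build R symM
  (fun A => Num.sqrt (frob A A)) (dot_ler_normD frobC frobDl frobZl frob_ge0 frob_eq0)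
  (dot_normrZ frobC frobZl) (dot_normr0_eq0 frob_ge0 frob_eq0).

Definition psd (B : symM) : Prop :=
  forall x : 'cV[R]_q, 0 <= (x^T *m (B : 'M[R]_q) *m x) ord0 ord0.

Definition psd_cone : set symM := [set B | psd B].

Definition psd_rank_le (m : nat) : set symM :=
  [set B | psd B /\ (\rank (B : 'M[R]_q) <= m)%N].

Definition sym_index := {p : 'I_q * 'I_q | (p.1 <= p.2)%N}.

Definition sym_basis_mx (p : sym_index) : 'M[R]_q :=
  let: (i, j) := val p in
  if i == j then delta_mx i i
  else (Num.sqrt 2)^-1 *: (delta_mx i j + delta_mx j i).

Fact sym_basis_subproof p : sym_basis_mx p \in is_symmx.
Proof.
rewrite unfold_in /is_symmx /sym_basis_mx; case: (val p) => i j.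
case: ifP => _; apply/eqP/matrixP => a b; rewrite !mxE; first by rewrite andbC.
by congr (_ * _); rewrite addrC; congr (_ %:R + _ %:R); rewrite andbC.
Qed.

Definition sym_basis (p : sym_index) : symM := SymM (sym_basis_subproof p).

End symmetric_matrices.

Section active_block.
Context (R : realType) (q k : nat).

Fact congr_sym_subproof (M : 'M[R]_(q, k)) (H : symM R q) :
  M^T *m H *m M \in is_symmx (R := R) (q := k).
Proof. by rewrite unfold_in !trmx_mul trmxK symM_tr mulmxA. Qed.

(* H |-> M^T H M; with M = U this is A_P, with M = U^T it is the adjoint of A_P *)
Definition congr_sym (M : 'M[R]_(q, k)) (H : symM R q) : symM R k :=
  SymM (congr_sym_subproof M H).

Definition orthonormal_kernel_basis (U : 'M[R]_(q, k)) (Sigma : symM R q) : Prop :=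
  U^T *m U = 1%:M /\
  forall x : 'cV[R]_q,
    (Sigma : 'M[R]_q) *m x = 0 <-> exists y : 'cV[R]_k, x = U *m y.

Definition T1cone (U : 'M[R]_(q, k)) : set (symM R q) :=
  [set H | psd_cone (congr_sym U H)].

Definition T0cone (U : 'M[R]_(q, k)) (m : nat) : set (symM R q) :=
  [set H | psd_rank_le m (congr_sym U H)].

End active_block.

Section parameter_space.
Context (R : realType) (d q : nat).

Definition param := ('cV[R]_d * symM R q)%type.

HB.instance Definition _ := GRing.Lmodule.copy param ('cV[R]_d * symM R q)%type.

Definition mkparam (a : 'cV[R]_d) (A : symM R q) : param := (a, A).

Definition pdot (x y : param) : R :=
  (x.1^T *m y.1) ord0 ord0 + frob x.2 y.2.

Let cdotE (a b : 'cV[R]_d) : (a^T *m b) ord0 ord0 = \sum_i a i ord0 * b i ord0.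
Proof. by rewrite mxE; apply: eq_bigr => i _; rewrite mxE. Qed.

Let cdot_ge0 (a : 'cV[R]_d) : 0 <= (a^T *m a) ord0 ord0.
Proof. by rewrite cdotE; apply: sumr_ge0 => ? _; rewrite -expr2 sqr_ge0. Qed.

Fact pdotC x y : pdot x y = pdot y x.
Proof.
rewrite /pdot frobC !cdotE; congr (_ + _).
by apply: eq_bigr => i _; rewrite mulrC.
Qed.

Fact pdotDl x y z : pdot (x + y) z = pdot x z + pdot y z.
Proof.
by rewrite /pdot /= frobDl linearD /= mulmxDl mxE addrACA.
Qed.

Fact pdotZl a x y : pdot (a *: x) y = a * pdot x y.
Proof. by rewrite /pdot /= frobZl linearZ /= -scalemxAl mxE mulrDr. Qed.

Fact pdot_ge0 x : 0 <= pdot x x.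
Proof. by rewrite addr_ge0 ?frob_ge0. Qed.

Fact pdot_eq0 x : pdot x x = 0 -> x = 0.
Proof.
move/eqP; rewrite /pdot paddr_eq0 ?frob_ge0// => /andP[/eqP h1 /eqP h2].
case: x h1 h2 => a A /= h1 /frob_eq0 ->; congr pair.
move: h1; rewrite cdotE => /eqP; rewrite psumr_eq0 => [/allP h|i _]; last first.
  by rewrite -expr2 sqr_ge0.
apply/matrixP => i j; rewrite ord1 mxE.
by have /(_ (mem_index_enum _)) := h i; rewrite /= mulf_eq0 orbb => /eqP.
Qed.

HB.instance Definition _ := @Lmodule_isNormed.Build R param
  (fun x => Num.sqrt (pdot x x)) (dot_ler_normD pdotC pdotDl pdotZl pdot_ge0 pdot_eq0)
  (dot_normrZ pdotC pdotZl) (dot_normr0_eq0 pdot_ge0 pdot_eq0).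

Definition nuisance_sum (T : set (symM R q)) : set param := [set h | T h.2].

Definition rescaled_set (theta0 : param) (Theta : set param) (n : nat) : set param :=
  [set h | Theta (theta0 + (Num.sqrt n%:R)^-1 *: h)].

End parameter_space.

Section operators.
Context (R : realType) (V : lmodType R).

Definition posdef_operator (dot : V -> V -> R) (f : V -> V) : Prop :=
  [/\ linear f,
      forall x y, dot (f x) y = dot x (f y)
    & forall x, x != 0 -> 0 < dot x (f x)].

(* Choice of a preimage: the inverse function whenever f is bijective. *)
Definition op_inv (f : V -> V) (y : V) : V := xget 0 [set x | f x = y].

(* The (unique) self-adjoint positive-definite square root. *)
Definition op_sqrt (dot : V -> V -> R) (f : V -> V) : V -> V :=
  @xget (V -> V) idfun [set g | posdef_operator dot g /\ forall x, g (g x) = f x].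

Definition op_invsqrt (dot : V -> V -> R) (f : V -> V) : V -> V :=
  op_inv (op_sqrt dot f).

End operators.

Definition setdist (R : realType) (V : normedModType R) (x : V) (A : set V) : R :=
  inf [set `|x - z| | z in A].

Section effective_information.
Context (R : realType) (d q k : nat).

(* I_{SigmaSigma} - I_{Sigma psi} I_{psi psi}^{-1} I_{psi Sigma} *)
Definition eff_info (J : param R d q -> param R d q) (H : symM R q) : symM R q :=
  let JSS H := (J (mkparam 0 H)).2 in
  let JSp a := (J (mkparam a 0)).2 in
  let Jpp a := (J (mkparam a 0)).1 in
  let JpS H := (J (mkparam 0 H)).1 in
  JSS H - JSp (op_inv Jpp (JpS H)).

Definition reduced_cov (J : param R d q -> param R d q) (U : 'M[R]_(q, k))
    (B : symM R k) : symM R k :=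
  congr_sym U (op_inv (eff_info J) (congr_sym U^T B)).

Definition Ccone (J : param R d q -> param R d q) (U : 'M[R]_(q, k)) :
    set (symM R k) :=
  op_invsqrt (@frob R k) (reduced_cov J U) @` @psd_cone R k.

Definition Dcone (J : param R d q -> param R d q) (U : 'M[R]_(q, k)) (m : nat) :
    set (symM R k) :=
  op_invsqrt (@frob R k) (reduced_cov J U) @` @psd_rank_le R k m.

Definition Delta (J : param R d q -> param R d q) (U : 'M[R]_(q, k)) (m : nat)
    (y : symM R k) : R :=
  setdist y (Dcone J U m) ^+ 2 - setdist y (Ccone J U) ^+ 2.

End effective_information.

Section hausdorff.
Context (R : realType) (V : normedModType R).
Local Open Scope ereal_scope.

Definition esetdist (x : V) (A : set V) : \bar R :=
  ereal_inf [set (`|x - z|%R)%:E | z in A].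

Definition hausdorff_dist (A B : set V) : \bar R :=
  maxe (ereal_sup [set esetdist x B | x in A])
       (ereal_sup [set esetdist x A | x in B]).

Definition cvg_on_bounded_sets (A : nat -> set V) (B : set V) : Prop :=
  forall rho : R, (0 < rho)%R ->
    let ball0 := [set h : V | (`|h| <= rho)%R] in
    hausdorff_dist (A n `&` ball0) (B `&` ball0) @[n --> \oo] --> 0.

End hausdorff.

(* Suprema of log-likelihoods need not be measurable, so probabilities and
   expectations of maps that are not assumed measurable are outer ones; they
   are the usual ones for measurable maps. *)

Section stochastic_convergence.
Context (R : realType) (dT : nat -> measure_display)
  (T : forall n, measurableType (dT n)) (P : forall n, probability (T n) R).
Local Open Scope ereal_scope.

Definition outer_expectation n (g : T n -> R) : \bar R :=
  ereal_inf [set 'E_(P n)[u] | u in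
    [set u : T n -> R | (P n).-integrable setT (EFin \o u) /\
                        forall w, (g w <= u w)%R]].

Definition cvg0_in_prob (X : forall n, T n -> \bar R) : Prop :=
  forall eps : R, (0 < eps)%R ->
    mu_ext (P n) [set w | eps%:E < `|X n w|] @[n --> \oo] --> 0.

Definition stochastically_bounded (V : normedModType R)
    (X : forall n, T n -> V) : Prop :=
  forall eps : R, (0 < eps)%R -> exists M : R,
    \forall n \near \oo, mu_ext (P n) [set w | (M < `|X n w|)%R] <= eps%:E.

Definition cvg_in_law (S : topologicalType) (X : forall n, T n -> S)
    (d : measure_display) (W : measurableType d) (Q : probability W R)
    (Y : W -> S) : Prop :=
  forall f : S -> R, continuous f -> (exists M : R, forall x, (`|f x| <= M)%R) ->
    outer_expectation (n := n) (f \o X n) @[n --> \oo] --> 'E_Q[f \o Y].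

(* With probability tending to one, hhat n is a maximiser of f n over A n. *)
Definition asymptotic_maximiser (V : Type) (A : nat -> set V)
    (f : forall n, V -> T n -> \bar R) (hhat : forall n, T n -> V) : Prop :=
  mu_ext (P n) [set w | ~ (A n (hhat n w) /\
                          forall h, A n h -> f n h w <= f n (hhat n w) w)]
    @[n --> \oo] --> 0.

End stochastic_convergence.

Definition random_element (d : measure_display) (T : measurableType d)
    (S : topologicalType) (X : T -> S) : Prop :=
  forall O : set S, open O -> measurable (X @^-1` O).

Section gaussian.
Context (R : realType) (d : measure_display) (T : measurableType d)
  (Q : probability T R).
Local Open Scope ereal_scope.

Definition mutually_independent (I : finType) (G : I -> T -> R) : Prop :=
  forall B : I -> set R, (forall i, measurable (B i)) ->
    Q (\bigcap_i (G i @^-1` B i)) = \big[*%E/1]_i Q (G i @^-1` B i).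

Definition iid_standard_normal (I : finType) (G : I -> T -> R) : Prop :=
  [/\ forall i, measurable_fun setT (G i),
      forall i (B : set R), measurable B ->
        Q (G i @^-1` B) = normal_prob 0%R 1%R B
    & mutually_independent G].

Definition standard_gaussian (k : nat) (Y : T -> symM R k) : Prop :=
  iid_standard_normal (fun (p : sym_index k) w => frob (Y w) (sym_basis R p)).

(* Z = L G with G standard normal in R^m and L L^* = J *)
Definition centered_gaussian (dpsi q : nat) (J : param R dpsi q -> param R dpsi q)
    (Z : T -> param R dpsi q) : Prop :=
  exists (m : nat) (L : 'cV[R]_m -> param R dpsi q) (G : 'I_m -> T -> R),
    [/\ linear L,
        iid_standard_normal G,
        forall w, Z w = L (\col_i G i w)
      & forall h h', pdot h (J h') =
          (\sum_(i < m) pdot h (L (delta_mx i ord0)) *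
                        pdot h' (L (delta_mx i ord0)))%R].

End gaussian.

Section experiment.
Context (R : realType) (dpsi q : nat).
Local Notation E := (param R dpsi q).
Local Open Scope ereal_scope.

(* p theta is a density of Pr theta with respect to a common sigma-finite
   measure, for every theta in D. *)
Definition is_likelihood (d : measure_display) (T : measurableType d)
    (Pr : E -> probability T R) (p : E -> T -> R) (D : set E) : Prop :=
  exists mu : {sigma_finite_measure set T -> \bar R},
    forall theta, D theta ->
      [/\ measurable_fun setT (p theta), forall x, (0 <= p theta x)%R
        & forall A, measurable A -> Pr theta A = \int[mu]_(x in A) (p theta x)%:E].

(* log 0 = -oo *)
Definition loglik (T : Type) (p : E -> T -> R) (theta : E) (x : T) : \bar R :=
  lne (p theta x)%:E.

Definition local_loglik (T : Type) (p : E -> T -> R) (theta0 : E) (n : nat)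
    (h : E) (x : T) : \bar R :=
  loglik p (theta0 + (Num.sqrt n%:R)^-1 *: h)%R x.

Definition LR_stat (T : Type) (p : E -> T -> R) (Theta0 Theta1 : set E) (x : T) :
    \bar R :=
  2%:E * (ereal_sup [set loglik p theta x | theta in Theta1] -
          ereal_sup [set loglik p theta x | theta in Theta0]).

Definition LAN (dT : nat -> measure_display) (T : forall n, measurableType (dT n))
    (P : forall n, probability (T n) R) (p : forall n, E -> T n -> R) (theta0 : E)
    (Z : forall n, T n -> E) (J : E -> E) : Prop :=
  forall C : set E, compact C -> C !=set0 ->
    cvg0_in_prob P (fun n x => ereal_sup
      [set `| local_loglik (p n) theta0 n h x - loglik (p n) theta0 x
              - (pdot h (Z n x))%:E + (pdot h (J h) / 2)%:E | | h in C]).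

End experiment.

(* Main.v *)
From HB Require Import structures.
Require Import Defs.
From mathcomp Require Import all_boot all_order all_algebra.
From mathcomp Require Import all_classical all_reals all_analysis.
From mathcomp Require Import measurable_realfun complex.
From mathcomp Require Import ring lra.

(** Write [ll h] for the log-likelihood at [theta0 + h / sqrt n]. By local asymptotic
    normality, on compact sets [ll h - ll 0] is close to the score
    [<h, z> - <h, J h> / 2] with [z = Zn]. The maximisers over the rescaled parameter
    sets are stochastically bounded and these sets are close to the tangent cones, so
    each constrained supremum of [ll h - ll 0] is, up to a small error, the supremum of
    the score over the tangent cone ([expansion_max], [profile_loglik_close]).

    The score over a cone [{h | A h \in K}], with [A] the active block, is maximised by
    completing the square: the supremum is half of
    [<z, J^-1 z> - dist^2 (W z, S^(-1/2) K)], where [S = A J^-1 A*] is the reduced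
    covariance (by block inversion, [eff_info_inv]) and [W = S^(-1/2) A J^-1]
    ([score_le], [score_approx]). In the difference of the two suprema the first term
    cancels, so the statistic is close to [Delta (W Zn)] ([Delta_whiteE]). As [Delta] is
    continuous, the statistic converges in law to [Delta (W Z)] ([cvg_in_law_of_close]).

    It remains to see that [W Z] is a standard Gaussian matrix. Its covariance is the
    identity ([whiten_cov]), so in an orthonormal basis its coordinates are orthonormal
    combinations of independent standard normal variables, and such combinations are
    independent standard normal ([iid_orthonormal_rows]). This rotation invariance is
    reduced by Givens elimination to the plane, and there to shears, which preserve the
    product Lebesgue measure by Fubini and translation invariance.

    Finally, [Delta (W z)] is twice a difference of suprema of the score over two cones
    that do not depend on the basis of the kernel ([Delta_white_basis]). So for two
    bases both laws are that of one and the same function of [Z]. *)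

Set Implicit Arguments.
Unset Strict Implicit.
Unset Printing Implicit Defensive.

Import Order.TTheory GRing.Theory Num.Theory.
Import numFieldNormedType.Exports.

Local Open Scope classical_set_scope.
Local Open Scope ring_scope.

(** * Rotation invariance of the planar Gaussian measure *)

Section planar_rotation.
Context {R : realType}.
Notation mu := (@lebesgue_measure R).
Local Open Scope ereal_scope.

Definition shift (a : R) : R -> measurableTypeR R := fun x => (x + a)%R.

Let measurable_shift a : measurable_fun setT (shift a).
Proof. exact: measurable_funD. Qed.


Lemma lebesgue_measure_shift (a : R) (A : set R) : measurable A ->
  pushforward mu (shift a) A = mu A.
Proof.
move=> mA; apply/esym/lebesgue_measure_unique => //=; first exact: measurable_shift.
move=> mf _ [[x y]] _ <-.
rewrite /pushforward.
rewrite (_ : _ @^-1` _ = `](x - a)%R, (y - a)%R]%classic); last first.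
  by apply/seteqP; split=> z /=; rewrite !in_itv/= ltrBlDr lerBrDr.
rewrite !lebesgue_measure_itv/= !lte_fin ltrD2r.
by case: ifP => // _; congr EFin; ring.
Qed.

Lemma ge0_integral_shift (a : R) (f : R -> \bar R) :
  measurable_fun setT f -> (forall x, 0 <= f x) ->
  \int[mu]_x f (x + a)%R = \int[mu]_x f x.
Proof.
move=> mf f0.
transitivity (\int[pushforward mu (shift a)]_x f x).
  by rewrite ge0_integral_pushforward//; exact: measurable_shift.
apply: eq_measure_integral => //=; first exact: measurable_shift.
by move=> ? A mA _; exact: lebesgue_measure_shift.
Qed.

(** Shears, unlike rotations, preserve the product Lebesgue measure by Fubini
    and one-dimensional translation invariance alone. *)
Definition shear1 (t : R) (z : R * R) : R * R := ((z.1 + t * z.2)%R, z.2).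
Definition shear2 (t : R) (z : R * R) : R * R := (z.1, (z.2 + t * z.1)%R).

Lemma measurable_shear1 t : measurable_fun setT (shear1 t).
Proof.
apply/measurable_fun_pair => //=.
by apply: measurable_funD => //; exact: measurable_funM.
Qed.

Lemma measurable_shear2 t : measurable_fun setT (shear2 t).
Proof.
apply/measurable_fun_pair => //=.
by apply: measurable_funD => //; exact: measurable_funM.
Qed.

Lemma integral_shear1 t (f : R * R -> \bar R) :
  measurable_fun setT f -> (forall x, 0 <= f x) ->
  \int[mu \x mu]_z f (shear1 t z) = \int[mu \x mu]_z f z.
Proof.
move=> mf f0.
have mft : measurable_fun setT (f \o shear1 t).
  by apply: measurableT_comp => //; exact: measurable_shear1.
rewrite (@fubini_tonelli2 _ _ _ _ _ mu mu _ mft (fun z => f0 (shear1 t z))).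
rewrite (@fubini_tonelli2 _ _ _ _ _ mu mu _ mf f0).
apply: eq_integral => y _; rewrite /fubini_G.
rewrite -[RHS](@ge0_integral_shift (t * y)%R)//.
exact: measurableT_comp.
Qed.

Lemma integral_shear2 t (f : R * R -> \bar R) :
  measurable_fun setT f -> (forall x, 0 <= f x) ->
  \int[mu \x mu]_z f (shear2 t z) = \int[mu \x mu]_z f z.
Proof.
move=> mf f0.
have mft : measurable_fun setT (f \o shear2 t).
  by apply: measurableT_comp => //; exact: measurable_shear2.
rewrite (@fubini_tonelli1 _ _ _ _ _ mu mu _ mft (fun z => f0 (shear2 t z))).
rewrite (@fubini_tonelli1 _ _ _ _ _ mu mu _ mf f0).
apply: eq_integral => x _; rewrite /fubini_F.
rewrite -[RHS](@ge0_integral_shift (t * x)%R)//.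
exact: measurableT_comp.
Qed.

Definition rot2 (c s : R) (z : R * R) : R * R :=
  ((c * z.1 + s * z.2)%R, (c * z.2 - s * z.1)%R).

(** The classical factorisation into three shears of a rotation whose angle is not
    a multiple of [pi]. *)
Lemma rot_shear (c s : R) : s != 0%R -> (c ^+ 2 + s ^+ 2 = 1)%R ->
  rot2 c s = shear1 ((1 - c) / s) \o shear2 (- s) \o shear1 ((1 - c) / s).
Proof.
move=> s0 cs; apply/funext => -[x y]; rewrite /rot2 /shear1 /shear2 /=.
have e : (c ^+ 2 = 1 - s ^+ 2)%R by rewrite -cs addrK.
by congr pair; field: e.
Qed.

Lemma measurable_rot2 c s : measurable_fun setT (rot2 c s).
Proof.
apply/measurable_fun_pair => //=.
  by apply: measurable_funD => //; exact: measurable_funM.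
by apply: measurable_funB => //; exact: measurable_funM.
Qed.

Lemma integral_rot2 c s (f : R * R -> \bar R) :
  s != 0%R -> (c ^+ 2 + s ^+ 2 = 1)%R ->
  measurable_fun setT f -> (forall x, 0 <= f x) ->
  \int[mu \x mu]_z f (rot2 c s z) = \int[mu \x mu]_z f z.
Proof.
move=> s0 cs mf f0; rewrite rot_shear//.
rewrite (@integral_shear1 _ (fun z => f (shear1 _ (shear2 _ z))))//.
  rewrite (@integral_shear2 _ (fun z => f (shear1 _ z)))//.
    exact: integral_shear1.
  by apply: measurableT_comp => //; exact: measurable_shear1.
apply: measurableT_comp => //; apply: measurableT_comp.
  exact: measurable_shear1.
exact: measurable_shear2.
Qed.

Definition normal_pdf2 (z : R * R) : R := (normal_pdf 0 1 z.1 * normal_pdf 0 1 z.2)%R.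

Lemma measurable_normal_pdf2 : measurable_fun setT normal_pdf2.
Proof.
by apply: measurable_funM; apply: measurableT_comp => //;
  exact: measurable_normal_pdf.
Qed.

Lemma normal_pdf2_ge0 z : (0 <= normal_pdf2 z)%R.
Proof. by rewrite mulr_ge0 ?normal_pdf_ge0. Qed.

Lemma normal_pdf01E (x : R) :
  normal_pdf 0 1 x = (normal_peak 1 * expR (- (x ^+ 2 / 2)))%R.
Proof.
rewrite normal_pdfE ?oner_eq0//; congr (_ * expR _)%R.
by rewrite subr0 expr1n mulNr.
Qed.

Lemma normal_pdf2_rot2 c s z : (c ^+ 2 + s ^+ 2 = 1)%R ->
  normal_pdf2 (rot2 c s z) = normal_pdf2 z.
Proof.
move=> cs; rewrite /normal_pdf2 !normal_pdf01E.
rewrite mulrACA [RHS]mulrACA -!expRD -!opprD -!mulrDl.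
suff -> : ((rot2 c s z).1 ^+ 2 + (rot2 c s z).2 ^+ 2 = z.1 ^+ 2 + z.2 ^+ 2)%R by [].
rewrite -[RHS]mul1r -cs /rot2/=; ring.
Qed.

(** The Gaussian measure of the plane, written through its density because the
    invariance is proved on Lebesgue integrals. *)
Definition normal_prob2 (A : set (R * R)) : \bar R :=
  \int[mu \x mu]_(z in A) (normal_pdf2 z)%:E.

Let normal_prob20 : normal_prob2 set0 = 0.
Proof. by rewrite /normal_prob2 integral_set0. Qed.

Let normal_prob2_ge0 A : 0 <= normal_prob2 A.
Proof. by apply: integral_ge0 => z _; rewrite lee_fin normal_pdf2_ge0. Qed.

Let normal_prob2_sigma_additive : semi_sigma_additive normal_prob2.
Proof.
move=> F mF tF mUF; rewrite /normal_prob2 ge0_integral_bigcup//=.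
- apply: is_cvg_ereal_nneg_natsum_cond => n _ _.
  exact: normal_prob2_ge0.
- by apply/measurable_funTS/measurable_EFinP; exact: measurable_normal_pdf2.
- by move=> x _; rewrite lee_fin normal_pdf2_ge0.
Qed.

HB.instance Definition _ := isMeasure.Build _ _ _ normal_prob2
  normal_prob20 normal_prob2_ge0 normal_prob2_sigma_additive.

Lemma normal_prob2X (A B : set R) : measurable A -> measurable B ->
  normal_prob2 (A `*` B) = normal_prob 0 1 A * normal_prob 0 1 B.
Proof.
move=> mA mB; rewrite /normal_prob2 integral_mkcond fubini_tonelli1/=; last 2 first.
- apply/(measurable_restrictT _ _).1; first exact: measurableX.
  by apply/measurable_funTS/measurable_EFinP; exact: measurable_normal_pdf2.
- by move=> z; apply: erestrict_ge0 => ? _; rewrite lee_fin normal_pdf2_ge0.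
rewrite /fubini_F /normal_prob.
have gE (x : R) : 0%R <= (normal_pdf 0 1 x : R)%:E :> \bar R by rewrite lee_fin normal_pdf_ge0.
have mg (D : set R) : measurable_fun D (EFin \o (normal_pdf 0 1 : R -> R)).
  by apply/measurable_funTS/measurable_EFinP; exact: measurable_normal_pdf.
rewrite -ge0_integralZr//; [|exact: mg|exact: integral_ge0].
rewrite [RHS]integral_mkcond; apply: eq_integral => x _ /=.
rewrite patchE; case: ifPn => xA.
  rewrite -ge0_integralZl//; last exact: mg.
  rewrite [RHS]integral_mkcond; apply: eq_integral => y _.
  rewrite !patchE in_setX /= xA /=; case: ifPn => //.
apply: integral0_eq => y _.
by rewrite patchE in_setX (negbTE xA).
Qed.

(** Both the Lebesgue measure and the density, a function of the norm, are
    invariant. *)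
Lemma normal_prob2_rot2 c s (A : set (R * R)) :
  s != 0%R -> (c ^+ 2 + s ^+ 2 = 1)%R -> measurable A ->
  normal_prob2 (rot2 c s @^-1` A) = normal_prob2 A.
Proof.
move=> s0 cs mA; rewrite /normal_prob2 integral_mkcond [RHS]integral_mkcond.
rewrite -[RHS](integral_rot2 s0 cs).
- apply: eq_integral => z _; rewrite !patchE normal_pdf2_rot2//.
- apply/(measurable_restrictT _ _).1 => //.
  by apply/measurable_funTS/measurable_EFinP; exact: measurable_normal_pdf2.
- by move=> z; apply: erestrict_ge0 => ? _; rewrite lee_fin normal_pdf2_ge0.
Qed.

End planar_rotation.

(** * Orthogonal transformations of independent standard normal variables *)

Section iid_rotation.
Context {R : realType} {d : measure_display} {T : measurableType d}
  (Q : probability T R) {K : finType}.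
Local Open Scope ereal_scope.

(** A single product formula carries both the marginals (take all the other
    factors to be the whole line) and the independence. *)
Lemma iid_standard_normalP (G : K -> T -> R) :
  iid_standard_normal Q G <->
  (forall i, measurable_fun setT (G i)) /\
  (forall B : K -> set R, (forall i, measurable (B i)) ->
    Q (\bigcap_i (G i @^-1` B i)) = \big[*%E/1]_i normal_prob 0%R 1%R (B i)).
Proof.
split=> [[mG lawG indG]|[mG prodG]].
  by split=> // B mB; rewrite indG//; apply: eq_bigr => i _; rewrite lawG.
have lawG i (B : set R) : measurable B -> Q (G i @^-1` B) = normal_prob 0%R 1%R B.
  move=> mB; pose B' k : set R := if k == i then B else setT.
  have -> : G i @^-1` B = \bigcap_k (G k @^-1` B' k).
    apply/seteqP; split=> [w Bw k _|w /(_ i I)]; rewrite /B' /= ?eqxx//.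
    by case: eqVneq => [->|].
  rewrite prodG => [|k]; last by rewrite /B'; case: ifP.
  rewrite (bigD1 i)//= big1 ?mule1; first by rewrite /B' eqxx.
  by move=> k /negbTE ki; rewrite /B' ki probability_setT.
by split=> // B mB; rewrite prodG//; apply: eq_bigr => i _; rewrite lawG.
Qed.

Lemma measure_eq_rect (m1 m2 : {measure set (R * R) -> \bar R}) :
  (forall A B : set R, measurable A -> measurable B ->
    m1 (A `*` B) = m2 (A `*` B)) -> m1 setT < +oo ->
  forall C, measurable C -> m1 C = m2 C.
Proof.
move=> m12 m1T C mC.
pose GG : set (set (R * R)) :=
  [set C | exists A, measurable A /\ exists B, measurable B /\ C = A `*` B].
apply: (measure_unique GG (fun=> setT)) => //.
- rewrite measurable_prod_measurableType //; congr (<<s _ >>).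
  rewrite predeqE; split => [[A mA [B mB <-]]|[A [mA [B [mB ->]]]]].
    by exists A; split => //; exists B.
  by exists A => //; exists B.
- move=> /= _ _ [X1 [mX1 [X2 [mX2 ->]]]] [Y1 [mY1 [Y2 [mY2 ->]]]].
  rewrite -setXI; exists (X1 `&` Y1); split; first exact: measurableI.
  by exists (X2 `&` Y2); split => //; exact: measurableI.
- by move=> n; exists setT; split => //; exists setT; split => //; rewrite setXTT.
- by rewrite bigcup_const//; exists 0%N.
- by move=> A [A1 [mA1 [A2 [mA2 ->]]]]; exact: m12.
Qed.

Definition givens (i j : K) (c s : R) (G : K -> T -> R) (k : K) (w : T) : R :=
  if k == i then (c * G i w + s * G j w)%R
  else if k == j then (c * G j w - s * G i w)%R else G k w.

(** With the other coordinates confined to fixed sets, the pair of coordinates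
    [i] and [j] has, up to the constant [kappa], the planar Gaussian law: the two
    measures agree on rectangles. Evaluating both on the preimage of a rectangle
    under the rotation gives the product formula of the rotated family. *)
Lemma iid_givens (i j : K) (c s : R) (G : K -> T -> R) : i != j ->
  s != 0%R -> (c ^+ 2 + s ^+ 2 = 1)%R ->
  iid_standard_normal Q G -> iid_standard_normal Q (givens i j c s G).
Proof.
move=> ij s0 cs /iid_standard_normalP[mG prodG]; apply/iid_standard_normalP.
split=> [k|B mB].
  rewrite /givens; case: eqP => _.
    by apply: measurable_funD; exact: measurable_funM.
  case: eqP => _; last exact: mG.
  by apply: measurable_funB; exact: measurable_funM.
pose others : set K := [set k | k != i /\ k != j].
pose E : set T := \bigcap_(k in others) (G k @^-1` B k).
have mE : measurable E.
  apply: fin_bigcap_measurable => // k _.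
  by rewrite -[X in measurable X]setTI; exact: mG.
pose pair w : R * R := (G i w, G j w).
have mpair : measurable_fun setT pair by exact/measurable_fun_pair.
have QE (C1 C2 : set R) : measurable C1 -> measurable C2 ->
    Q (pair @^-1` (C1 `*` C2) `&` E) = normal_prob 0%R 1%R C1 *
      normal_prob 0%R 1%R C2 *
      \big[*%E/1]_(k | (k != i) && (k != j)) normal_prob 0%R 1%R (B k).
  move=> mC1 mC2.
  pose B' k := if k == i then C1 else if k == j then C2 else B k.
  have -> : pair @^-1` (C1 `*` C2) `&` E = \bigcap_k (G k @^-1` B' k).
    apply/seteqP; split=> [w [[/= w1 w2] Ew] k _ /=|w Bw].
      rewrite /B'; case: eqVneq => [->//|ki]; case: eqVneq => [->//|kj].
      exact: Ew.
    split; first split=> /=.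
    - by have /= := Bw i I; rewrite /B' eqxx.
    - by have /= := Bw j I; rewrite /B' eqxx eq_sym (negbTE ij).
    - move=> k [ki kj] /=.
      by have /= := Bw k I; rewrite /B' (negbTE ki) (negbTE kj).
  rewrite prodG => [|k]; last first.
    by rewrite /B'; case: ifP => // _; case: ifP.
  rewrite (bigD1 i)//= (bigD1 j)/=; last by rewrite eq_sym.
  rewrite muleA /B' eqxx eq_sym (negbTE ij) eqxx; congr (_ * _).
  by apply: eq_bigr => k /andP[/negbTE -> /negbTE ->].
set kappa := \big[*%E/1]_(k | (k != i) && (k != j)) normal_prob 0%R 1%R (B k) in QE.
have kappa_fin : kappa \is a fin_num.
  apply: prode_fin_num => k _.
  exact: (fin_num_measure (normal_prob 0%R 1%R) (B k) (mB k)).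
have kappa_ge0 : (0 <= fine kappa)%R.
  by apply/fine_ge0/prode_ge0 => k _; exact: measure_ge0.
have key C : measurable C -> pushforward (mrestr Q mE) pair C =
    mscale (NngNum kappa_ge0) normal_prob2 C.
  move: C; apply: measure_eq_rect => //= [C1 C2 mC1 mC2|].
    rewrite /pushforward /mrestr QE// /mscale/= normal_prob2X// muleC.
    by rewrite fineK.
  rewrite /pushforward /mrestr preimage_setT setTI.
  by rewrite (le_lt_trans (probability_le1 _ _))// ltry.
have mrot : measurable (rot2 c s @^-1` (B i `*` B j)).
  by rewrite -[X in measurable X]setTI; apply: measurable_rot2 => //; exact: measurableX.
have -> : \bigcap_k (givens i j c s G k @^-1` B k) =
    pair @^-1` (rot2 c s @^-1` (B i `*` B j)) `&` E.
  apply/seteqP; split=> [w Bw|w [[/= w1 w2] Ew] k _ /=].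
    split=> [|k [/negbTE ki /negbTE kj] /=]; first split=> /=.
    - by have /= := Bw i I; rewrite /givens eqxx.
    - by have /= := Bw j I; rewrite /givens eqxx eq_sym (negbTE ij).
    - by have /= := Bw k I; rewrite /givens ki kj.
  rewrite /givens; case: eqVneq => [->//|ki]; case: eqVneq => [->//|kj].
  exact: Ew.
have := key _ mrot; rewrite {1}/pushforward /mrestr => ->.
rewrite /mscale/= normal_prob2_rot2//; last exact: measurableX.
rewrite normal_prob2X// fineK// (bigD1 i)//= (bigD1 j)/=; last by rewrite eq_sym.
by rewrite muleA muleC.
Qed.

End iid_rotation.

Section iid_sign_subfamily.
Context {R : realType} {d : measure_display} {T : measurableType d}
  (Q : probability T R) {K : finType}.
Local Open Scope ereal_scope.

(** The symmetry of the normal law is read off a quarter turn of the plane. *)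
Lemma normal_prob_opp (B : set R) : measurable B ->
  normal_prob 0%R 1%R (-%R @^-1` B) = normal_prob 0%R 1%R B.
Proof.
move=> mB.
have mNB : measurable (-%R @^-1` B : set R).
  by rewrite -[X in measurable X]setTI; exact: oppr_measurable.
have := @normal_prob2_rot2 R 0%R 1%R (setT `*` B) (oner_neq0 _) _
  (measurableX measurableT mB).
rewrite (_ : rot2 _ _ @^-1` _ = (-%R @^-1` B : set R) `*` setT); last first.
  apply/seteqP; split=> -[x y] /=; rewrite mul0r mul1r sub0r.
    by move=> [].
  by move=> [].
rewrite !normal_prob2X// probability_setT mul1e mule1; apply.
by rewrite expr0n expr1n add0r.
Qed.

Lemma iid_sign (b : K -> R) (G : K -> T -> R) : (forall k, b k ^+ 2 = 1)%R ->
  iid_standard_normal Q G -> iid_standard_normal Q (fun k w => (b k * G k w)%R).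
Proof.
move=> b1 /iid_standard_normalP[mG prodG]; apply/iid_standard_normalP.
split=> [k|B mB]; first exact: measurable_funM.
have mbB k : measurable ( *%R (b k) @^-1` B k : set R).
  by rewrite -[X in measurable X]setTI; exact: mulrl_measurable.
have := prodG _ mbB; rewrite /preimage /= => ->; apply: eq_bigr => k _.
have /eqP := b1 k; rewrite sqrf_eq1 => /orP[/eqP ->|/eqP ->].
  by congr normal_prob; apply/seteqP; split=> x /=; rewrite mul1r.
rewrite -[RHS]normal_prob_opp//.
by congr normal_prob; apply/seteqP; split=> x /=; rewrite mulN1r.
Qed.

Lemma iid_subfamily (L : finType) (f : L -> K) (G : K -> T -> R) : injective f ->
  iid_standard_normal Q G -> iid_standard_normal Q (G \o f).
Proof.
move=> f_inj /iid_standard_normalP[mG prodG]; apply/iid_standard_normalP.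
split=> [l|B mB]; first exact: mG.
pose g k := [pick l | f l == k].
have gf l : g (f l) = Some l.
  rewrite /g; case: pickP => [l' /eqP /f_inj ->//|/(_ l)].
  by rewrite eqxx.
pose B' k := if g k is Some l then B l else setT.
have -> : \bigcap_l ((G \o f) l @^-1` B l) = \bigcap_k (G k @^-1` B' k).
  apply/seteqP; split=> w Bw.
    move=> k _; rewrite /B' /= /g; case: pickP => [l /eqP <-|//].
    exact: Bw.
  by move=> l _; have /= := Bw (f l) I; rewrite /B' gf.
rewrite prodG => [|k]; last by rewrite /B'; case: (g k).
rewrite (bigID (fun k => k \in codom f))/= [X in _ * X]big1 ?mule1; last first.
  move=> k /negP kf; rewrite /B' /g; case: pickP => [l /eqP flk|_].
    by case: kf; rewrite -flk codom_f.
  exact: probability_setT.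
rewrite (reindex_omap f g) => [|k /codomP[l ->]]; last by rewrite gf.
apply: eq_big => [l|l _]; first by rewrite codom_f gf eqxx.
by rewrite /B' gf.
Qed.

End iid_sign_subfamily.

Section iid_orthonormal_rows.
Context {R : realType} {d : measure_display} {T : measurableType d}
  (Q : probability T R).

Definition lincomb N m (A : 'M[R]_(N, m)) (G : 'I_m -> T -> R) (k : 'I_N) (w : T) : R :=
  \sum_i A k i * G i w.

Lemma lincombM N m p (A : 'M[R]_(N, m)) (B : 'M[R]_(m, p)) G :
  lincomb (A *m B) G = lincomb A (lincomb B G).
Proof.
apply/funext => k; apply/funext => w; rewrite /lincomb.
under eq_bigr do rewrite mxE mulr_suml.
rewrite exchange_big /=; apply: eq_bigr => i _; rewrite mulr_sumr.
by apply: eq_bigr => j _; rewrite mulrA.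
Qed.

Lemma lincomb1 m G : lincomb (1%:M : 'M[R]_m) G = G.
Proof.
apply/funext => k; apply/funext => w; rewrite /lincomb (bigD1 k)//= big1.
  by rewrite mxE eqxx mul1r addr0.
by move=> i ik; rewrite mxE eq_sym (negbTE ik) mul0r.
Qed.

Variable m : nat.

Definition iid_invariant (V : 'M[R]_m) : Prop :=
  V *m V^T = 1%:M /\
  forall G, iid_standard_normal Q G -> iid_standard_normal Q (lincomb V G).

Lemma iid_invariant1 : iid_invariant 1%:M.
Proof. by split=> [|G]; rewrite ?trmx1 ?mulmx1 ?lincomb1. Qed.

Lemma iid_invariantM O1 O2 :
  iid_invariant O1 -> iid_invariant O2 -> iid_invariant (O1 *m O2).
Proof.
move=> [orth1 inv1] [orth2 inv2]; split=> [|G iG].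
  by rewrite trmx_mul mulmxA -(mulmxA O1) orth2 mulmx1.
by rewrite lincombM; exact/inv1/inv2.
Qed.

Section givens_matrix.
Variables (i j : 'I_m) (c s : R).
Hypotheses (ij : i != j) (cs : c ^+ 2 + s ^+ 2 = 1).

Definition givens_mx : 'M[R]_m := \matrix_(k, l)
  if k == i then (if l == i then c else if l == j then s else 0)
  else if k == j then (if l == j then c else if l == i then - s else 0)
  else (l == k)%:R.

Lemma sum_givens_mx (f : 'I_m -> R) k : \sum_l givens_mx k l * f l =
  if k == i then c * f i + s * f j else if k == j then c * f j - s * f i else f k.
Proof.
have [->|ki] := eqVneq k i.
  rewrite (bigD1 i)//= (bigD1 j) 1?eq_sym//= big1 => [|l /andP[/negbTE li /negbTE lj]].
    by rewrite !mxE !eqxx eq_sym (negbTE ij) addr0.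
  by rewrite !mxE eqxx li lj mul0r.
have [->|kj] := eqVneq k j.
  rewrite (bigD1 j)//= (bigD1 i)//= big1 => [|l /andP[/negbTE lj /negbTE li]].
    by rewrite !mxE !eqxx eq_sym (negbTE ij) addr0 mulNr.
  by rewrite !mxE eqxx eq_sym (negbTE ij) li lj mul0r.
rewrite (bigD1 k)//= big1 => [|l /negbTE lk].
  by rewrite mxE (negbTE ki) (negbTE kj) eqxx mul1r addr0.
by rewrite mxE (negbTE ki) (negbTE kj) lk mul0r.
Qed.

Lemma iid_invariant_givens : s != 0 -> iid_invariant givens_mx.
Proof.
move=> s0; split=> [|G iG]; last first.
  rewrite (_ : lincomb _ _ = givens i j c s G); first exact: iid_givens.
  by apply/funext => k; apply/funext => w; rewrite /lincomb sum_givens_mx.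
have ji : (j == i) = false by rewrite eq_sym (negbTE ij).
apply/matrixP => k l; rewrite mxE; under eq_bigr do rewrite [_^T _ _]mxE.
rewrite sum_givens_mx !mxE !eqxx ji (negbTE ij).
have [->|ki] := eqVneq k i.
  have [_|li] := eqVneq l i; first by rewrite -!expr2.
  by have [_|lj] := eqVneq l j; rewrite ?mulr0 ?addr0// mulrN mulrC addNr.
have [->|kj] := eqVneq k j.
  have [->|li] := eqVneq l i; first by rewrite ji mulrC subrr.
  have [_|lj] := eqVneq l j; last by rewrite !mulr0 subr0.
  by rewrite mulrN opprK -!expr2.
have [->|li] := eqVneq l i; first by rewrite (negbTE ki).
have [->|lj] := eqVneq l j; first by rewrite (negbTE kj).
by [].
Qed.

End givens_matrix.

Definition fixes_below n (V : 'M[R]_m) : Prop := forall i : 'I_m, (i < n)%N ->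
  delta_mx 0 i *m V = delta_mx 0 i :> 'rV_m /\
  delta_mx 0 i *m V^T = delta_mx 0 i :> 'rV_m.

Lemma row_givens_mxT (i j k : 'I_m) c s (v : 'rV[R]_m) : i != j ->
  (v *m (givens_mx i j c s)^T) 0 k =
  if k == i then c * v 0 i + s * v 0 j
  else if k == j then c * v 0 j - s * v 0 i else v 0 k.
Proof.
move=> ij; rewrite mxE -(sum_givens_mx _ _ ij); apply: eq_bigr => l _.
by rewrite mxE mulrC.
Qed.

(** Givens elimination: rotations in the planes [(n, j)] with [j > n] clear the
    entries of [v] after position [n] one at a time and leave the first [n] basis
    vectors alone. *)
Lemma exists_zero_tail (n : 'I_m) (v : 'rV[R]_m) (t : nat) : (t <= m)%N ->
  exists V, [/\ iid_invariant V, fixes_below n V &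
    forall j : 'I_m, (n < j < t)%N -> (v *m V^T) 0 j = 0].
Proof.
elim: t => [_|t IH tm].
  exists 1%:M; split; [exact: iid_invariant1| |by move=> j; rewrite ltn0 andbF].
  by move=> i _; rewrite trmx1 mulmx1.
have [V [invO fixO zeroO]] := IH (ltnW tm).
pose j := Ordinal tm; pose v' := v *m V^T.
have [jn|nj] := leqP j n.
  exists V; split=> // k /andP[nk]; rewrite ltnS leq_eqVlt => /orP[/eqP kt|kt].
    by move: jn; rewrite leqNgt /= -kt nk.
  by apply: zeroO; rewrite nk.
have [v'j|v'j] := eqVneq (v' 0 j) 0.
  exists V; split=> // k /andP[nk]; rewrite ltnS leq_eqVlt => /orP[/eqP kt|kt].
    by rewrite (_ : k = j) //; exact/val_inj.
  by apply: zeroO; rewrite nk.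
pose r := Num.sqrt (v' 0 n ^+ 2 + v' 0 j ^+ 2).
have r2 : r ^+ 2 = v' 0 n ^+ 2 + v' 0 j ^+ 2.
  by rewrite sqr_sqrtr// addr_ge0// sqr_ge0.
have r0 : r != 0.
  rewrite -sqrf_eq0 r2 paddr_eq0 ?sqr_ge0// !sqrf_eq0 (negbTE v'j).
  by rewrite andbF.
have njne : n != j by rewrite -val_eqE neq_ltn nj.
pose c := v' 0 n / r; pose s := v' 0 j / r.
have cs : c ^+ 2 + s ^+ 2 = 1.
  by rewrite !expr_div_n -mulrDl -r2 divff// expf_neq0.
have s0 : s != 0 by rewrite mulf_neq0// invr_neq0.
have fixg : fixes_below n (givens_mx n j c s).
  have fixT (i : 'I_m) : (i < n)%N ->
      delta_mx 0 i *m (givens_mx n j c s)^T = delta_mx 0 i :> 'rV_m.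
    move=> ltin; have ineq : (i == n) = false by apply: ltn_eqF.
    have ijeq : (i == j) = false by apply: ltn_eqF; exact: ltn_trans nj.
    apply/rowP => k; rewrite (row_givens_mxT _ _ _ _ njne) !mxE /= ![_ == i]eq_sym ineq ijeq.
    rewrite !mulr0 addr0 subr0.
    have [->|kn] := eqVneq k n; first by rewrite ineq.
    by have [->|//] := eqVneq k j; rewrite ijeq.
  move=> i ltin; split; last exact: fixT.
  rewrite -[in LHS](fixT i ltin) -mulmxA.
  by rewrite (mulmx1C (proj1 (iid_invariant_givens njne cs s0))) mulmx1.
exists (givens_mx n j c s *m V); split.
- by apply: iid_invariantM => //; exact: iid_invariant_givens.
- move=> i ltin; have [f1 f2] := fixO i ltin; have [g1 g2] := fixg i ltin.
  by rewrite mulmxA g1 f1 trmx_mul mulmxA f2 g2.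
- move=> k /andP[nk]; rewrite ltnS leq_eqVlt trmx_mul mulmxA (row_givens_mxT _ _ _ _ njne) -/v'.
  have kn : (k == n) = false by rewrite eq_sym; exact: ltn_eqF.
  move=> /orP[/eqP kt|kt].
    have -> : k = j by exact/val_inj.
    by rewrite eqxx eq_sym (negbTE njne) /c /s; field.
  have -> : (k == j) = false by apply: ltn_eqF.
  by rewrite kn; apply: zeroO; rewrite nk.
Qed.

(** Elimination row by row turns orthonormal rows into plus or minus the first
    basis vectors. Orthogonality to the rows already treated kills the entries
    before the diagonal, so a row is nonzero only if a column is still free; this
    is where [t <= m] comes from. *)
Lemma exists_sign_rows N (A : 'M[R]_(N, m)) (t : nat) : A *m A^T = 1%:M ->
  (t <= N)%N -> (t <= m)%N /\ exists2 V, iid_invariant V &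
    forall (k : 'I_N) (i : 'I_m), (k < t)%N -> val k != val i -> (A *m V^T) k i = 0.
Proof.
move=> AA; elim: t => [_|t IH tN].
  by split=> //; exists 1%:M => //; exact: iid_invariant1.
have [tm [V invO zeroO]] := IH (ltnW tN).
have [B defB] : exists B, B = A *m V^T by eexists.
rewrite -defB in zeroO.
have BB : B *m B^T = 1%:M.
  rewrite defB trmx_mul trmxK mulmxA -(mulmxA A) (mulmx1C (proj1 invO)) mulmx1.
  exact: AA.
pose kt := Ordinal tN.
have diag (k : 'I_N) (i : 'I_m) : (k < t)%N -> val k = val i -> B k i != 0.
  move=> kltt ki; have := congr1 (fun X : 'M[R]_N => X k k) BB.
  rewrite !mxE eqxx (bigD1 i)//= big1 ?addr0.
    rewrite [B^T _ _]mxE => /eqP; apply: contraTneq => ->.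
    by rewrite mul0r eq_sym oner_eq0.
  by move=> l li; rewrite zeroO ?mul0r// ki eq_sym.
have below (i : 'I_m) : (i < t)%N -> B kt i = 0.
  move=> it; have iN : (i < N)%N := ltn_trans it tN.
  have := congr1 (fun X : 'M[R]_N => X kt (Ordinal iN)) BB.
  rewrite !mxE -val_eqE /= gtn_eqF// (bigD1 i)//= big1 ?addr0.
    rewrite [B^T _ _]mxE => /eqP; rewrite mulf_eq0 => /orP[/eqP//|].
    by rewrite (negbTE (diag (Ordinal iN) i _ _)).
  by move=> l li; rewrite [B^T _ _]mxE (zeroO (Ordinal iN)) ?mulr0//= eq_sym.
have tltm : (t < m)%N.
  rewrite ltn_neqAle tm andbT; apply/eqP => tE.
  have := congr1 (fun X : 'M[R]_N => X kt kt) BB.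
  rewrite !mxE eqxx big1 => [/eqP|l _]; first by rewrite eq_sym oner_eq0.
  by rewrite below ?mul0r// tE.
split=> //.
have [V' [invO' fixO' zeroO']] := exists_zero_tail (Ordinal tltm) (row kt B) (leqnn m).
exists (V' *m V); first exact: iid_invariantM.
move=> k i kt1 ki; rewrite trmx_mul mulmxA -defB.
have rowBE : (B *m V'^T) k i = (row k B *m V'^T) 0 i.
  by rewrite -row_mul [RHS]mxE.
have dotE (u : 'rV[R]_m) : (i < t)%N -> (u *m V'^T) 0 i = u 0 i.
  move=> it; have [f1 _] := fixO' i it; rewrite -rowE in f1.
  have V'i l : V' i l = (l == i)%:R.
    by have := congr1 (fun X : 'rV[R]_m => X 0 l) f1; rewrite !mxE eqxx.
  rewrite mxE (bigD1 i)//= big1 => [|l li].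
    by rewrite mxE V'i eqxx mulr1 addr0.
  by rewrite mxE V'i (negbTE li) mulr0.
rewrite rowBE; move: kt1; rewrite ltnS leq_eqVlt => /orP[/eqP kE|klt].
  have -> : k = kt by exact/val_inj.
  have [it|] := ltnP i t; first by rewrite dotE// mxE below.
  rewrite leq_eqVlt => /orP[/eqP ti|ti]; first by move: ki; rewrite /= kE ti eqxx.
  by apply: zeroO'; rewrite /= ti ltn_ord.
have km : (k < m)%N := ltn_trans klt tltm.
have rowk : row k B = B k (Ordinal km) *: delta_mx 0 (Ordinal km).
  apply/rowP => l; rewrite !mxE /=.
  have [->|lk] := eqVneq l (Ordinal km); first by rewrite mulr1.
  by rewrite mulr0 zeroO//; apply: contra lk => /eqP kl; apply/eqP/val_inj.
rewrite rowk -scalemxAl; have [_ ->] := fixO' (Ordinal km) klt.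
rewrite !mxE /= -val_eqE /= eq_sym (negbTE ki) mulr0.
by [].
Qed.

(** Rotation invariance in the form used below. After the elimination, the rows
    of [A] select coordinates of an independent family, up to sign. *)
Lemma iid_orthonormal_rows N (A : 'M[R]_(N, m)) G : A *m A^T = 1%:M ->
  iid_standard_normal Q G -> iid_standard_normal Q (lincomb A G).
Proof.
move=> AA iG.
have [Nm [V invO zeroO]] := exists_sign_rows AA (leqnn N).
have [OO iO] := invO.
pose B := A *m V^T; pose f (k : 'I_N) : 'I_m := widen_ord Nm k.
have -> : lincomb A G = fun k w => B k (f k) * (lincomb V G \o f) k w.
  have -> : A = B *m V by rewrite -mulmxA (mulmx1C OO) mulmx1.
  rewrite lincombM; apply/funext => k; apply/funext => w.
  rewrite {1}/lincomb (bigD1 (f k))//= big1 ?addr0// => i ik.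
  rewrite zeroO ?mul0r//; apply: contra ik => /eqP ki.
  by apply/eqP/val_inj.
apply: iid_sign; last first.
  apply: iid_subfamily; last exact: iO.
  by move=> k l /(congr1 val) /= /val_inj.
move=> k; have : (B *m B^T) k k = 1.
  rewrite /B trmx_mul trmxK mulmxA -(mulmxA A) (mulmx1C OO) mulmx1.
  by rewrite AA mxE eqxx.
rewrite mxE (bigD1 (f k))//= big1 ?addr0.
  by rewrite [B^T _ _]mxE expr2.
move=> i ik; rewrite zeroO ?mul0r//; apply: contra ik => /eqP ki.
by apply/eqP/val_inj.
Qed.

End iid_orthonormal_rows.

(** * Law of a continuous function of independent standard normal variables *)

Section continuous_of_measurable.
Context {R : realType}.

Definition grid_floor n (x : R) : R := (Num.floor (n.+1%:R * x))%:~R / n.+1%:R.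

Lemma cvg_grid_floor (x : R) : grid_floor n x @[n --> \oo] --> x.
Proof.
apply/cvgrPdist_le => e e0; near=> n.
have n0 : (0 < n.+1%:R :> R) by rewrite ltr0n.
rewrite /grid_floor -[X in `|X - _|](mulfK (lt0r_neq0 n0)) -mulrBl (mulrC x).
rewrite normrM normfV (ger0_norm (ltW n0)) ler_pdivrMr//.
rewrite ger0_norm ?subr_ge0 ?floor_le_tmp//.
apply: (@le_trans _ _ 1).
  by rewrite lerBlDl; apply: ltW; rewrite -[1]/(1%:~R) -intrD1 floorD1_gt.
rewrite -ler_pdivrMr// div1r; apply: ltW.
by near: n; exact: (near_infty_natSinv_lt (PosNum e0)).
Unshelve. all: by end_near. Qed.

Lemma cvg_col m (V : Type) (F : set_system V) {FF : Filter F}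
    (f : 'I_m -> V -> R) (l : 'I_m -> R) :
  (forall i, f i x @[x --> F] --> l i) ->
  (\col_i f i x : 'cV[R]_m) @[x --> F] --> (\col_i l i : 'cV[R]_m).
Proof.
move=> fl; apply/cvgrPdist_le => e e0.
have : \forall x \near F, forall i, `|l i - f i x| <= e.
  by apply: filter_forall => i; move/cvgrPdist_le : (fl i); exact.
apply: filterS => x lf; rewrite [leLHS]/Num.norm/= mx_normrE.
by apply: bigmax_le => [|[i j] _]; [exact: ltW | rewrite !mxE; exact: lf].
Qed.

(** Rounding the coordinates down to a grid of mesh [1 / n.+1] makes the function
    depend on countably many measurable cells, and the rounded functions converge
    pointwise by continuity. *)
Lemma measurable_continuous_coord d (T : measurableType d) m
    (phi : 'cV[R]_m -> R) (G : 'I_m -> T -> R) :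
  continuous phi -> (forall i, measurable_fun setT (G i)) ->
  measurable_fun setT (fun w => phi (\col_i G i w)).
Proof.
move=> cphi mG.
apply: (@measurable_fun_cvg _ _ _ setT
  (fun n w => phi (\col_i grid_floor n (G i w)))) => [n|w _]; last first.
  apply: continuous_cvg; first exact: cphi.
  by apply: cvg_col => i; exact: cvg_grid_floor.
move=> _ B mB; rewrite setTI.
pose val_ (c : {ffun 'I_m -> int}) : 'cV[R]_m := \col_i ((c i)%:~R / n.+1%:R).
pose cell (c : {ffun 'I_m -> int}) : set T :=
  \bigcap_(i in setT) (G i @^-1` [set x | Num.floor (n.+1%:R * x) = c i]).
have -> : (fun w => phi (\col_i grid_floor n (G i w))) @^-1` B =
    \bigcup_c (if `[< B (phi (val_ c)) >] then cell c else set0).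
  apply/seteqP; split=> [w Bw|w [c _]].
    pose c := [ffun i => Num.floor (n.+1%:R * G i w)].
    exists c => //; case: asboolP => [_ i _|[]]; first by rewrite /= ffunE.
    rewrite (_ : val_ c = \col_i grid_floor n (G i w))//.
    by apply/matrixP => i j; rewrite !mxE ffunE.
  case: asboolP => // Bc cw /=.
  rewrite (_ : \col_i _ = val_ c)//; apply/matrixP => i j; rewrite !mxE.
  by rewrite /grid_floor (cw i).
apply: countable_bigcupT_measurable; first exact: countableP.
move=> c; case: asboolP => // _; apply: fin_bigcap_measurable => // i _.
rewrite -[X in measurable X]setTI; apply: mG => //.
have n0 : (0 < n.+1%:R :> R) by rewrite ltr0n.
rewrite (_ : mkset _ = `[(c i)%:~R / n.+1%:R, (c i + 1)%:~R / n.+1%:R[%classic)//.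
apply/seteqP; split=> x /=; rewrite in_itv/= ler_pdivrMr// ltr_pdivlMr// mulrC.
  by move=> <-; rewrite floor_le_tmp floorD1_gt.
by move=> /floor_def.
Qed.

End continuous_of_measurable.

Section iid_law.
Context {R : realType}.

Lemma measurable_tuple_box m (B : 'I_m -> set R) :
  (forall i, measurable (B i)) ->
  measurable [set t : m.-tuple R | forall i, B i (tnth t i)].
Proof.
move=> mB; rewrite (_ : mkset _ = \bigcap_(i in setT) ((@tnth _ R ^~ i) @^-1` B i)).
  apply: fin_bigcap_measurable => // i _.
  by rewrite -[X in measurable X]setTI; exact: measurable_tnth.
by apply/seteqP; split=> t Bt i => [_|]; exact: Bt.
Qed.

(** Boxes are stable under intersection and generate the product sigma-algebra,
    and on boxes both probabilities are the same product of normal probabilities. *)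
Lemma iid_law m (d d' : measure_display) (T : measurableType d)
    (T' : measurableType d') (Q : probability T R) (Q' : probability T' R)
    (G : 'I_m -> T -> R) (G' : 'I_m -> T' -> R) (A : set (m.-tuple R)) :
  iid_standard_normal Q G -> iid_standard_normal Q' G' -> measurable A ->
  Q [set w | A [tuple G i w | i < m]] = Q' [set w | A [tuple G' i w | i < m]].
Proof.
move=> /iid_standard_normalP[mG prodG] /iid_standard_normalP[mG' prodG'] mA.
pose g w := [tuple G i w | i < m]; pose g' w := [tuple G' i w | i < m].
have mg : measurable_fun setT g.
  apply/measurable_fun_tnthP => i; rewrite (_ : _ \o _ = G i)//.
  by apply/funext => w /=; rewrite tnth_mktuple.
have mg' : measurable_fun setT g'.
  apply/measurable_fun_tnthP => i; rewrite (_ : _ \o _ = G' i)//.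
  by apply/funext => w /=; rewrite tnth_mktuple.
pose boxes : set (set (m.-tuple R)) := [set A | exists2 B : 'I_m -> set R,
  forall i, measurable (B i) & A = [set t | forall i, B i (tnth t i)]].
rewrite -[LHS]/(pushforward Q g A) -[RHS]/(pushforward Q' g' A).
apply: (g_sigma_algebra_measure_unique boxes _ (fun=> setT)) => //.
- by move=> _ [B mB ->]; exact: measurable_tuple_box.
- by move=> _; exists (fun=> setT) => //; apply/seteqP; split.
- by rewrite bigcup_const//; exists 0%N.
- move=> _ _ [B mB ->] [C mC ->]; exists (fun i => B i `&` C i).
    by move=> i; exact: measurableI.
  apply/seteqP; split=> [t [Bt Ct] i|t BCt]; first by split.
  by split=> i; have [] := BCt i.
- move=> _ [B mB ->]; rewrite /pushforward.
  transitivity (\big[*%E/1%E]_i normal_prob 0 1 (B i)).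
    rewrite -prodG//; congr (Q _); apply/seteqP; split=> w /= Bw.
      by move=> i _; have /= := Bw i; rewrite tnth_mktuple.
    by move=> i; rewrite tnth_mktuple; exact: Bw.
  rewrite -prodG'//; congr (Q' _); apply/seteqP; split=> w /= Bw.
    by move=> i; rewrite tnth_mktuple; exact: Bw.
  by move=> i _; have /= := Bw i; rewrite tnth_mktuple.
- by move=> _; change (Q (g @^-1` setT) < +oo)%E; rewrite preimage_setT probability_setT ltry.
- move: A mA; apply: smallest_sub.
    exact: smallest_sigma_algebra.
  apply: (big_ind (fun S : set (set (m.-tuple R)) => S `<=` <<s boxes >>)) => //.
    by move=> S1 S2 sub1 sub2; rewrite subUset.
  move=> i _ _ [Y mY <-]; apply: sub_sigma_algebra; rewrite setTI.
  exists (fun k => if k == i then Y else setT).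
    by move=> k; case: ifP.
  apply/seteqP; split=> t /= Yt; first by move=> k; case: eqVneq => // ->.
  by have := Yt i; rewrite eqxx.
Qed.

Lemma iid_law_continuous (K : finType) (d d' : measure_display) (T : measurableType d)
    (T' : measurableType d') (Q : probability T R) (Q' : probability T' R)
    (G : K -> T -> R) (G' : K -> T' -> R) (phi : 'cV[R]_#|K| -> R) (B : set R) :
  iid_standard_normal Q G -> iid_standard_normal Q' G' ->
  continuous phi -> measurable B ->
  Q [set w | B (phi (\col_i G (enum_val i) w))] =
  Q' [set w | B (phi (\col_i G' (enum_val i) w))].
Proof.
move=> iG iG' cphi mB.
pose psi (t : #|K|.-tuple R) := phi (\col_i tnth t i).
have mpsi : measurable_fun setT psi.
  by apply: measurable_continuous_coord => // i; exact: measurable_tnth.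
have mA : measurable (psi @^-1` B) by rewrite -[X in measurable X]setTI; exact: mpsi.
have psiE (V : Type) (H : K -> V -> R) w :
    psi [tuple (H \o enum_val) i w | i < #|K|] = phi (\col_i H (enum_val i) w).
  by congr phi; apply/matrixP => a b; rewrite !mxE tnth_mktuple.
under eq_set do rewrite -psiE; under [in RHS]eq_set do rewrite -psiE.
exact: (iid_law (iid_subfamily enum_val_inj iG) (iid_subfamily enum_val_inj iG') mA).
Qed.

End iid_law.

(** * Square roots of positive definite matrices *)

Section matrix_square_root.
Context {R : realType}.
Local Notation C := (complex R).

Lemma self_dot_gt0 n (x : 'cV[R]_n) : x != 0 -> 0 < (x^T *m x) 0 0.
Proof.
move=> x0; have xxE : (x^T *m x) 0 0 = \sum_j x j 0 ^+ 2.
  by rewrite mxE; apply: eq_bigr => j _; rewrite mxE expr2.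
rewrite xxE lt_neqAle sumr_ge0 ?andbT => [|j _]; last exact: sqr_ge0.
apply: contra x0; rewrite eq_sym psumr_eq0 => [/allP xx|j _]; last exact: sqr_ge0.
apply/eqP/colP => j; rewrite mxE; apply/eqP; rewrite -sqrf_eq0.
exact: (xx j (mem_index_enum _)).
Qed.

Lemma poly_interpolation (f : R -> R) (s : seq R) :
  exists p : {poly R}, forall x, x \in s -> p.[x] = f x.
Proof.
elim: s => [|x s [p pE]]; first by exists 0.
have [xs|xs] := boolP (x \in s).
  by exists p => y; rewrite inE => /predU1P[->|]; exact: pE.
pose q := \prod_(y <- s) ('X - y%:P).
have qx : q.[x] != 0 by rewrite -/(root q x) root_prod_XsubC.
exists (p + ((f x - p.[x]) / q.[x]) *: q) => y; rewrite inE hornerD hornerZ.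
have [->|yx /= ys] := eqVneq y x; first by rewrite divfK// addrC subrK.
have /eqP -> : root q y by rewrite root_prod_XsubC.
by rewrite mulr0 addr0 pE.
Qed.

(** The spectral theorem for complex Hermitian matrices, applied to a real
    symmetric matrix: the eigenvalues are real, and they are eigenvalues of the
    real matrix because the characteristic polynomial is real. *)
Lemma symmetric_spectrum n (M : 'M[R]_n.+1) : M^T = M ->
  exists2 P : 'M[C]_n.+1, P \in unitmx &
  exists2 l : 'I_n.+1 -> R, (forall i, eigenvalue M (l i)) &
    map_mx (real_complex R) M =
      invmx P *m diag_mx (\row_i real_complex R (l i)) *m P.
Proof.
move=> Msym; set MC := map_mx _ M.
have MCherm : MC \is hermsymmx.
  apply: realsym_hermsym.
    by apply/is_hermitianmxP; rewrite expr0 scale1r map_mx_id// map_trmx Msym.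
  by apply/mxOverP => i j; rewrite mxE; apply/complex_realP; exists (M i j).
have /orthomx_spectralP MCE := hermitian_normalmx MCherm.
have /mxOverP spreal := hermitian_spectral_diag_real MCherm.
exists (spectralmx MC); first exact: spectral_unit.
have spE i : spectral_diag MC 0 i = real_complex R (complex.Re (spectral_diag MC 0 i)).
  by rewrite RRe_real.
exists (fun i => complex.Re (spectral_diag MC 0 i)); last first.
  rewrite {1}MCE; congr (_ *m diag_mx _ *m _).
  by apply/rowP => i; rewrite mxE.
move=> i; rewrite eigenvalue_root_char -(fmorph_root (real_complex R)).
rewrite map_char_poly -/MC -eigenvalue_root_char /= -spE.
apply/eigenvalueP; exists (delta_mx 0 i *m spectralmx MC).
  rewrite {2}MCE !mulmxA mulmxK ?spectral_unit// scalemxAl.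
  congr (_ *m _); apply/rowP => j; rewrite mul_mx_diag !mxE eqxx /=.
  by have [->|] := eqVneq j i; rewrite ?mulr1 ?mul1r ?mulr0 ?mul0r.
apply/eqP => /(congr1 (mulmx^~ (invmx (spectralmx MC)))).
rewrite mulmxK ?spectral_unit// mul0mx => /rowP/(_ i)/eqP.
by rewrite !mxE !eqxx oner_eq0.
Qed.

(** If [p] interpolates the fourth root at the eigenvalues then [W = p(M)] is real
    and symmetric with [W ^+ 4 = M], and [W *m W] is the square root. Fourth roots
    make positivity immediate: the quadratic form of [W *m W] at [x] is the squared
    norm of [W *m x]. *)
Lemma posdef_mx_sqrt n (M : 'M[R]_n) : M^T = M ->
  (forall x : 'cV_n, x != 0 -> 0 < (x^T *m M *m x) 0 0) ->
  exists T : 'M[R]_n, [/\ T^T = T, T *m T = M &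
    forall x : 'cV_n, x != 0 -> 0 < (x^T *m T *m x) 0 0].
Proof.
case: n M => [|n] M Msym Mpos; first by exists M; split=> //; rewrite [LHS]flatmx0 [RHS]flatmx0.
have [P Pu [l leig ME]] := symmetric_spectrum Msym.
have l0 i : 0 < l i.
  have /eigenvalueP[v vM v0] := leig i.
  have := Mpos v^T; rewrite trmxK trmx_eq0 => /(_ v0).
  rewrite vM -scalemxAl mxE pmulr_lgt0//.
  by rewrite -{1}[v]trmxK; apply: self_dot_gt0; rewrite trmx_eq0.
have [p pE] := poly_interpolation (fun x => Num.sqrt (Num.sqrt x)) (codom l).
have pl i : p.[l i] ^+ 4 = l i.
  rewrite pE ?codom_f// (exprM _ 2 2) sqr_sqrtr ?sqrtr_ge0// sqr_sqrtr//.
  exact: ltW.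
pose W := horner_mx M p.
have W4 : W ^+ 4 = M.
  apply: (@map_mx_inj _ _ (real_complex R)).
  rewrite -rmorphXn /= map_horner_mx /= ME horner_mx_uconjC// horner_mx_diag.
  congr (_ *m diag_mx _ *m _); apply/rowP => i; rewrite !mxE.
  by rewrite horner_map /= horner_exp pl.
have WT : W^T = W.
  rewrite /W; elim/poly_ind: (p) => [|q c IH]; first by rewrite rmorph0 trmx0.
  rewrite rmorphD rmorphM /= horner_mx_X horner_mx_C linearD /= tr_scalar_mx.
  by rewrite trmx_mul IH Msym; congr (_ + _); apply: comm_mx_horner.
have W2 : (W *m W) *m (W *m W) = M.
  by rewrite -[RHS]W4 (exprM _ 2 2) !expr2.
exists (W *m W); split=> //; first by rewrite trmx_mul WT.
move=> x x0; have -> : x^T *m (W *m W) *m x = (W *m x)^T *m (W *m x).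
  by rewrite trmx_mul WT !mulmxA.
apply: self_dot_gt0; apply/negP => /eqP Wx0.
by have := Mpos x x0; rewrite -W2 -!mulmxA Wx0 !mulmx0 mxE ltxx.
Qed.

End matrix_square_root.

(** * Euclidean spaces and positive definite operators *)

(** The matrix, parameter and column spaces carry different inner products, each
    an explicit function. This packages one such product with an orthonormal basis,
    so that everything about operators and continuity is proved once. *)
Record euclidean_basis (R : realType) (V : lmodType R) (dot : V -> V -> R)
    (N : nat) (e : 'I_N -> V) : Prop := EuclideanBasis {
  dot_sym : forall x y, dot x y = dot y x ;
  dot_addl : forall x y z, dot (x + y) z = dot x z + dot y z ;
  dot_scalel : forall a x y, dot (a *: x) y = a * dot x y ;
  dot_basis : forall i j, dot (e i) (e j) = (i == j)%:R ;
  dot_span : forall x, x = \sum_i dot x (e i) *: e i }.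

Section euclidean.
Context {R : realType} {V : lmodType R} {dot : V -> V -> R} {N : nat}.
Context {e : 'I_N -> V} (eb : euclidean_basis dot e).

Lemma dot_addr x y z : dot x (y + z) = dot x y + dot x z.
Proof. by rewrite !(dot_sym eb x) (dot_addl eb). Qed.

Lemma dot0l x : dot 0 x = 0.
Proof. by have := dot_scalel eb 0 0 x; rewrite scale0r mul0r. Qed.

Lemma dot0r x : dot x 0 = 0.
Proof. by rewrite (dot_sym eb) dot0l. Qed.

Lemma dot_suml I (r : seq I) (P : pred I) (F : I -> V) y :
  dot (\sum_(i <- r | P i) F i) y = \sum_(i <- r | P i) dot (F i) y.
Proof.
apply: (big_morph (dot^~ y)) => [u v|]; first exact: (dot_addl eb).
exact: dot0l.
Qed.

Definition coords (x : V) : 'cV[R]_N := \col_i dot x (e i).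
Definition of_coords (a : 'cV[R]_N) : V := \sum_i a i 0 *: e i.

Lemma coordsK : cancel coords of_coords.
Proof.
by move=> x; rewrite [RHS](dot_span eb); apply: eq_bigr => i _; rewrite mxE.
Qed.

Lemma of_coordsK : cancel of_coords coords.
Proof.
move=> a; apply/colP => i; rewrite mxE dot_suml (bigD1 i)//= big1 => [|j ji].
  by rewrite (dot_scalel eb) (dot_basis eb) eqxx mulr1 addr0.
by rewrite (dot_scalel eb) (dot_basis eb) (negbTE ji) mulr0.
Qed.

Lemma coords_linear a x y : coords (a *: x + y) = a *: coords x + coords y.
Proof. by apply/colP => i; rewrite !mxE (dot_addl eb) (dot_scalel eb). Qed.

Lemma of_coords_linear a x y :
  of_coords (a *: x + y) = a *: of_coords x + of_coords y.
Proof.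
by apply: (can_inj coordsK); rewrite coords_linear !of_coordsK.
Qed.

Lemma dot_coords x y : dot x y = ((coords x)^T *m coords y) 0 0.
Proof.
rewrite {1}(dot_span eb x) dot_suml mxE; apply: eq_bigr => i _.
by rewrite !mxE (dot_scalel eb) (dot_sym eb y).
Qed.

Lemma dot_self_ge0 x : 0 <= dot x x.
Proof.
rewrite dot_coords mxE; apply: sumr_ge0 => i _.
by rewrite mxE -expr2 sqr_ge0.
Qed.

Section posdef.
Variable f : V -> V.
Hypothesis fpos : posdef_operator dot f.

Let flin : linear f. Proof. by case: fpos. Qed.

Let f0 : f 0 = 0.
Proof. by have := flin (-1) 0 0; rewrite scaler0 addr0 scaleN1r addNr. Qed.

Lemma posdef_sym x y : dot (f x) y = dot x (f y). Proof. by case: fpos. Qed.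

Definition op_mx : 'M[R]_N := \matrix_(i, j) dot (e i) (f (e j)).

(** In coordinates an operator is a symmetric positive definite matrix, which
    transfers surjectivity and square roots from matrices. *)
Lemma coords_op x : coords (f x) = op_mx *m coords x.
Proof.
apply/colP => i; rewrite !mxE posdef_sym (dot_span eb x) dot_suml.
apply: eq_bigr => j _; rewrite !mxE (dot_scalel eb) mulrC -posdef_sym (dot_sym eb).
congr (_ * _); rewrite -(dot_span eb x) //.
Qed.

Lemma op_mx_sym : op_mx^T = op_mx.
Proof. by apply/matrixP => i j; rewrite !mxE -posdef_sym (dot_sym eb). Qed.

Lemma op_mx_pos (a : 'cV_N) : a != 0 -> 0 < (a^T *m op_mx *m a) 0 0.
Proof.
move=> a0; case: fpos => _ _ /(_ (of_coords a)).
rewrite dot_coords coords_op of_coordsK mulmxA; apply.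
apply: contra a0 => /eqP a0; rewrite -(of_coordsK a) a0; apply/eqP/colP => i.
by rewrite !mxE dot0l.
Qed.

Lemma posdef_inj : injective f.
Proof.
move=> x y fxy; apply/eqP; rewrite -subr_eq0; apply/negPn/negP => xy.
case: fpos => _ _ /(_ _ xy).
have -> : f (x - y) = 0.
  by rewrite addrC -scaleN1r flin fxy scaleN1r addNr.
by rewrite dot0r ltxx.
Qed.

Lemma posdef_surj y : exists x, f x = y.
Proof.
have Mu : op_mx \in unitmx.
  rewrite -row_free_unit -kermx_eq0; apply/negPn/negP => /rowV0Pn[v].
  move=> /sub_kermxP vM v0; have := @op_mx_pos v^T.
  by rewrite trmx_eq0 trmxK vM mul0mx mxE ltxx => /(_ v0).
exists (of_coords (invmx op_mx *m coords y)).
by apply: (can_inj coordsK); rewrite coords_op of_coordsK mulKVmx.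
Qed.

Lemma op_invK y : f (op_inv f y) = y.
Proof.
rewrite /op_inv; case: xgetP => [x _ -> //|none].
by have [x fx] := posdef_surj y; case: (none x).
Qed.

Lemma op_invE x y : f x = y -> op_inv f y = x.
Proof. by move=> fx; apply: posdef_inj; rewrite op_invK. Qed.

Lemma posdef_ge0 x : 0 <= dot x (f x).
Proof.
have [->|x0] := eqVneq x 0; first by rewrite dot0l.
by case: fpos => _ _ /(_ _ x0) /ltW.
Qed.

Lemma posdef_cauchy_schwarz x y : dot x (f y) ^+ 2 <= dot x (f x) * dot y (f y).
Proof.
case: (fpos) => fl fs fp.
apply: (dot_cauchy_schwarz (dot := fun x y => dot x (f y))).
- by move=> u v; rewrite -fs (dot_sym eb).
- by move=> u v w; rewrite (dot_addl eb).
- by move=> a u v; rewrite (dot_scalel eb).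
- exact: posdef_ge0.
- by move=> u /eqP uu; apply/eqP/negPn/negP => /fp; rewrite lt0r uu.
Qed.

Lemma posdef_inv : posdef_operator dot (op_inv f).
Proof.
split=> [a x y|x y|x x0].
- by apply: op_invE; rewrite flin !op_invK.
- by rewrite -{2}(op_invK x) posdef_sym op_invK.
- case: fpos => _ _ /(_ (op_inv f x)); rewrite op_invK (dot_sym eb); apply.
  apply: contra x0 => /eqP ix0; by rewrite -(op_invK x) ix0 f0.
Qed.

Lemma posdef_sqrt_exists :
  exists g, posdef_operator dot g /\ forall x, g (g x) = f x.
Proof.
have [T [Tsym TT Tpos]] := posdef_mx_sqrt op_mx_sym op_mx_pos.
pose g x := of_coords (T *m coords x); exists g; split; last first.
  move=> x; apply: (can_inj coordsK).
  by rewrite !of_coordsK mulmxA TT coords_op.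
split=> [a x y|x y|x x0].
- by rewrite /g coords_linear mulmxDr -scalemxAr of_coords_linear.
- by rewrite !dot_coords !of_coordsK trmx_mul Tsym mulmxA.
- rewrite dot_coords of_coordsK mulmxA; apply: Tpos.
  apply: contra x0 => /eqP x0; rewrite -(coordsK x) x0.
  by apply/eqP/big1 => i _; rewrite mxE scale0r.
Qed.

(** The chosen function is a square root as soon as there is one. *)
Lemma op_sqrtP :
  posdef_operator dot (op_sqrt dot f) /\ forall x, op_sqrt dot f (op_sqrt dot f x) = f x.
Proof.
rewrite /op_sqrt; case: xgetP => [g _ //|none].
by have [g gP] := posdef_sqrt_exists; case: (none g).
Qed.

End posdef.
End euclidean.

(** * Distance to a set *)

Section setdist_lemmas.
Context {R : realType} {V : normedModType R}.
Implicit Types (A : set V).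

Lemma setdist_has_lbound x A : has_lbound [set `|x - z| | z in A].
Proof. by exists 0 => _ [z _ <-]. Qed.

Lemma setdist_le x A z : A z -> setdist x A <= `|x - z|.
Proof. by move=> Az; apply: ge_inf; [exact: setdist_has_lbound|exists z]. Qed.

Lemma setdist_ge0 x A : A !=set0 -> 0 <= setdist x A.
Proof.
move=> [z Az]; apply: lb_le_inf; first by exists `|x - z|, z.
by move=> _ [y _ <-].
Qed.

Lemma setdist_lt x A (e : R) : A !=set0 -> 0 < e ->
  exists2 z, A z & `|x - z| < setdist x A + e.
Proof.
move=> [z0 Az0] e0; have : has_inf [set `|x - z| | z in A].
  by split; [exists `|x - z0|, z0|exact: setdist_has_lbound].
by move=> /(inf_adherent e0)[_ [z Az <-] ?]; exists z.
Qed.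

Lemma setdist_lipschitz x y A : A !=set0 -> setdist x A <= setdist y A + `|x - y|.
Proof.
move=> A0; apply/ler_addgt0Pr => e e0.
have [z Az yz] := setdist_lt y A0 e0.
rewrite (le_trans (setdist_le x Az))// (_ : x - z = (x - y) + (y - z)).
  by rewrite (le_trans (ler_normD _ _))// addrC -addrA (addrC _ e) addrA lerD2r ltW.
by rewrite addrA subrK.
Qed.

Lemma continuous_setdist A : A !=set0 -> continuous (fun x => setdist x A).
Proof.
move=> A0 x; apply/cvgrPdist_le => e e0; near=> y.
have xy : `|x - y| <= e by near: y; exact: cvgr_dist_le.
have := setdist_lipschitz x y A0; have := setdist_lipschitz y x A0.
by rewrite (distrC y) ler_norml => ? ?; apply/andP; split; lra.
Unshelve. all: by end_near. Qed.

Lemma continuous_sqr_setdist_sub A B : A !=set0 -> B !=set0 ->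
  continuous (fun x => setdist x A ^+ 2 - setdist x B ^+ 2).
Proof.
move=> A0 B0 x; have sq C : C !=set0 ->
    setdist y C ^+ 2 @[y --> x] --> setdist x C ^+ 2.
  move=> C0; apply: (@continuous_comp _ _ _ (fun y => setdist y C) (fun r => r ^+ 2)).
    exact: continuous_setdist.
  exact: exprn_continuous.
by apply: cvgB; exact: sq.
Qed.

End setdist_lemmas.

(** * The quadratic programme behind the limit *)

(** Throughout, [A] maps a local parameter to the block that the constraint sees,
    [At] is its adjoint and [S] is the compression [A J^-1 At] of the inverse
    information. The whitened score is [S^(-1/2) A J^-1 z]. *)
Section whitening.
Context {R : realType} {V : lmodType R} {dV : V -> V -> R} {NV : nat}.
Context {eV : 'I_NV -> V} (eb : euclidean_basis dV eV).
Context {W : normedModType R} {dW : W -> W -> R} {NW : nat}.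
Context {eW : 'I_NW -> W} (eb' : euclidean_basis dW eW).
Hypothesis normE : forall x : W, `|x| = Num.sqrt (dW x x).
Variables (J : V -> V) (A : V -> W) (At : W -> V) (S : W -> W).
Hypothesis Jpos : posdef_operator dV J.
Hypothesis Alin : linear A.
Hypothesis Aadj : forall x y, dW (A x) y = dV x (At y).
Hypothesis Spos : posdef_operator dW S.
Hypothesis SE : forall y, S y = A (op_inv J (At y)).

Let Ji := op_inv J.
Let T := op_invsqrt dW S.
Let g := op_sqrt dW S.

Let gpos : posdef_operator dW g. Proof. by have [] := op_sqrtP eb' Spos. Qed.
Let gg x : g (g x) = S x. Proof. by have [_] := op_sqrtP eb' Spos. Qed.
Let Tpos : posdef_operator dW T. Proof. exact: (posdef_inv eb' gpos). Qed.
Let gK x : g (T x) = x. Proof. exact: (op_invK eb' gpos). Qed.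
Let JiK x : J (Ji x) = x. Proof. exact: (op_invK eb Jpos). Qed.
Let Jipos : posdef_operator dV Ji. Proof. exact: (posdef_inv eb Jpos). Qed.

Definition whiten (z : V) : W := T (A (Ji z)).
Definition whiten_adj (y : W) : V := Ji (At (T y)).

Lemma whiten_linear : linear whiten.
Proof.
case: Tpos => Tl _ _; case: Jipos => Jl _ _.
by move=> a x y; rewrite /whiten Jl Alin Tl.
Qed.

Lemma whiten_adjE z y : dW (whiten z) y = dV z (whiten_adj y).
Proof.
by rewrite /whiten (posdef_sym Tpos) Aadj (posdef_sym Jipos).
Qed.

(** If [z] has covariance [J] then [whiten z] has identity covariance: this is
    [S^(-1/2) (A J^-1) J (J^-1 At) S^(-1/2) = 1]. *)
Lemma whiten_cov x y : dV (whiten_adj x) (J (whiten_adj y)) = dW x y.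
Proof.
by rewrite /whiten_adj JiK -Aadj -SE -gg gK (posdef_sym gpos) gK.
Qed.

Let normsq x : `|x| ^+ 2 = dW x x.
Proof. by rewrite normE sqr_sqrtr ?(dot_self_ge0 eb'). Qed.

Definition score (z h : V) : R := dV h z - dV h (J h) / 2.
(** The supremum of [score z] over the [h] with [A h] in [K], in closed form. It
    is taken as a definition; that it is the supremum is [score_le] together with
    [score_approx]. *)
Definition max_score (K : set W) (z : V) : R :=
  (dV z (Ji z) - setdist (whiten z) (T @` K) ^+ 2) / 2.

(** Completing the square at the unconstrained maximiser [J^-1 z]. *)
Lemma score_shift z u : score z (Ji z + u) = (dV z (Ji z) - dV u (J u)) / 2.
Proof.
case: (Jpos) => Jl Js _; have JD x y : J (x + y) = J x + J y.
  by have := Jl 1 x y; rewrite !scale1r.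
rewrite /score JD JiK !(dot_addl eb) !(dot_addr eb).
have -> : dV (Ji z) (J u) = dV u z by rewrite -Js JiK (dot_sym eb).
by rewrite (dot_sym eb (Ji z)); field.
Qed.

(** Minimising the information norm over all [u] with a given block [A u] costs
    exactly the whitened norm of the block; this is the lower bound, by
    Cauchy-Schwarz in the [J] inner product against the extremal direction
    [whiten_adj v]. *)
Lemma whiten_contract u : dW (T (A u)) (T (A u)) <= dV u (J u).
Proof.
set v := T (A u); have [->|v0] := eqVneq v 0.
  by rewrite (dot0l eb') (posdef_ge0 eb Jpos).
have vv : 0 < dW v v.
  rewrite lt_neqAle (dot_self_ge0 eb') andbT eq_sym; apply: contra v0 => /eqP vv0.
  by rewrite -normr_eq0 normE vv0 sqrtr0.
have : dV u (J (whiten_adj v)) = dW v v.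
  by rewrite /whiten_adj JiK -Aadj -(posdef_sym Tpos).
move=> uv; have := posdef_cauchy_schwarz eb Jpos u (whiten_adj v).
by rewrite uv whiten_cov expr2 ler_pM2r.
Qed.

Lemma score_le K z h : K (A h) -> score z h <= max_score K z.
Proof.
move=> Kh; pose u := h - Ji z.
have -> : h = Ji z + u by rewrite addrC subrK.
rewrite score_shift /max_score ler_pM2r ?invr_gt0// lerD2l lerN2.
apply: le_trans (whiten_contract u); rewrite -normsq.
have Au : T (A u) = T (A h) - whiten z.
  case: Tpos => Tl _ _.
  by rewrite /u addrC -scaleN1r Alin Tl scaleN1r addrC.
rewrite Au ler_pXn2r ?nnegrE ?setdist_ge0//; last by exists (T (A h)), (A h).
by rewrite distrC; apply: setdist_le; exists (A h).
Qed.

(** Any block [B] in [K] is reached from [J^-1 z] along the extremal direction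
    [whiten_adj v], where the bound of [whiten_contract] is an equality. As [K] is
    not assumed closed, the distance is only approached. *)
Lemma score_approx K z (e : R) : K !=set0 -> 0 < e ->
  exists2 h, K (A h) & max_score K z - e <= score z h.
Proof.
move=> [B0 KB0] e0.
have K0 : (T @` K) !=set0 by exists (T B0), B0.
set dist := setdist (whiten z) (T @` K).
have d0 : 0 <= dist by exact: setdist_ge0.
(* chosen so that (dist + de)^2 <= dist^2 + 2 e *)
pose de := Num.min 1 (e / (dist + 1)).
have de0 : 0 < de by rewrite lt_min ltr01/= divr_gt0// ltr_wpDl.
have [_ [B KB <-]] := setdist_lt (whiten z) K0 de0; rewrite -/dist => Bd.
pose v := T B - whiten z.
pose u := whiten_adj v.
have Au : A u = B - A (Ji z).
  have vE : v = T (B - A (Ji z)).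
    case: Tpos => Tl _ _.
    by rewrite [B - _]addrC -scaleN1r Tl scaleN1r addrC.
  by rewrite /u /whiten_adj -SE -gg gK vE gK.
exists (Ji z + u).
  have AD x y : A (x + y) = A x + A y by have := Alin 1 x y; rewrite !scale1r.
  by rewrite AD Au addrC subrK.
rewrite score_shift whiten_cov -normsq /v distrC /max_score -/dist.
set b := `|_|.
have b0 : 0 <= b by exact: normr_ge0.
have : b ^+ 2 <= (dist + de) ^+ 2.
  by rewrite ler_pXn2r ?nnegrE ?addr_ge0 ?(ltW de0)//; exact: ltW.
have : (dist + de) ^+ 2 <= dist ^+ 2 + 2 * e.
  rewrite sqrrD -addrA lerD2l -mulrnAl.
  have de1 : de <= 1 by rewrite ge_min lexx.
  have de2 : de * (dist + 1) <= e.
    by rewrite -ler_pdivlMr ?ltr_wpDl// ge_min lexx orbT.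
  nra.
lra.
Qed.

Lemma max_score_diff K K' z : 2 * (max_score K' z - max_score K z) =
  setdist (whiten z) (T @` K) ^+ 2 - setdist (whiten z) (T @` K') ^+ 2.
Proof. by rewrite /max_score; field. Qed.

End whitening.

(** * Orthonormal bases and the norm topology of the parameter spaces *)

Section symM_basis.
Context {R : realType} {k : nat}.

Lemma symM_entryC (A : symM R k) i j : (A : 'M[R]_k) i j = (A : 'M[R]_k) j i.
Proof. by rewrite -[in RHS](symM_tr A) mxE. Qed.

Lemma symM_sumE I (r : seq I) (P : pred I) (F : I -> symM R k) a b :
  ((\sum_(i <- r | P i) F i : symM R k) : 'M[R]_k) a b =
  \sum_(i <- r | P i) (F i : 'M[R]_k) a b.
Proof.
by apply: (big_morph (fun A : symM R k => (A : 'M[R]_k) a b)) => [A B|];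
  rewrite mxE.
Qed.

(** Restricting to entries on or above the diagonal makes each basis matrix have a
    single nonzero entry. *)
Lemma sym_basis_entry (p : sym_index k) (a b : 'I_k) : (a <= b)%N ->
  (sym_basis R p : 'M[R]_k) a b =
  (val p == (a, b))%:R * (if a == b then 1 else (Num.sqrt 2)^-1).
Proof.
case: p => -[i j] /= ij ab; rewrite /sym_basis_mx /= xpair_eqE.
have [<-{j ij}|ij'] := eqVneq i j.
  rewrite mxE [a == i]eq_sym [b == i]eq_sym.
  have [ia|_] := eqVneq i a; last by rewrite mul0r.
  have [ib|_] := eqVneq i b; last by rewrite mul0r.
  by rewrite -ia -ib eqxx mulr1.
rewrite !mxE.
have -> : (a == j) && (b == i) = false.
  apply/negP => /andP[/eqP aj /eqP bi]; move: ij'; rewrite -val_eqE eqn_leq ij /=.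
  by rewrite -aj -bi ab.
rewrite addr0 [a == i]eq_sym [b == j]eq_sym mulrC.
have [ia|_] := eqVneq i a; last by rewrite !mul0r.
have [jb|_] := eqVneq j b; last by rewrite !mul0r.
by rewrite -ia -jb (negbTE ij').
Qed.

Lemma frob_sym_basis (A : symM R k) (p : sym_index k) :
  frob A (sym_basis R p) =
  if (val p).1 == (val p).2 then (A : 'M[R]_k) (val p).1 (val p).2
  else Num.sqrt 2 * (A : 'M[R]_k) (val p).1 (val p).2.
Proof.
case: p => -[i j] /= ij; rewrite frobE /=.
rewrite (eq_bigr (fun a => \sum_b (A : 'M[R]_k) a b * (sym_basis_mx R (exist _ (i, j) ij)) a b))//.
rewrite /sym_basis_mx /=.
have sum_delta (B : 'M[R]_k) i' j' : \sum_a \sum_b B a b * delta_mx i' j' a b = B i' j'.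
  rewrite (bigD1 i')//= (bigD1 j')//= !big1 => [|a ai|b bj].
  - by rewrite mxE !eqxx mulr1 !addr0.
  - by rewrite big1// => b _; rewrite mxE (negbTE ai) mulr0.
  - by rewrite mxE (negbTE bj) andbF mulr0.
have [->|ij'] := eqVneq i j; first exact: sum_delta.
transitivity ((Num.sqrt 2)^-1 *
    (\sum_a \sum_b (A : 'M[R]_k) a b * delta_mx i j a b +
     \sum_a \sum_b (A : 'M[R]_k) a b * delta_mx j i a b)).
  rewrite -big_split mulr_sumr; apply: eq_bigr => a _ /=.
  rewrite -big_split mulr_sumr; apply: eq_bigr => b _ /=.
  by rewrite [LHS]/= mxE [(_ + _ : 'M[R]_k) _ _]mxE -mulrDr mulrCA.
rewrite !sum_delta (symM_entryC A j i) -mulr2n -[X in _ * X]mulr_natl mulrA.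
congr (_ * _); apply: (mulfI (_ : Num.sqrt 2 != 0)); first by rewrite sqrtr_eq0 -ltNge.
by rewrite mulrA divff ?mul1r -?expr2 ?sqr_sqrtr// sqrtr_eq0 -ltNge.
Qed.

Lemma sym_basis_orthonormal (p p' : sym_index k) :
  frob (sym_basis R p) (sym_basis R p') = (p == p')%:R.
Proof.
rewrite frob_sym_basis !sym_basis_entry ?(valP p')//.
rewrite -val_eqE -surjective_pairing; case: eqVneq => [//|ij].
  by rewrite mulr1.
by rewrite mulrCA divff ?mulr1// sqrtr_eq0 -ltNge.
Qed.

Lemma sym_basis_span (A : symM R k) :
  A = \sum_(p : sym_index k) frob A (sym_basis R p) *: sym_basis R p.
Proof.
have upper (a b : 'I_k) : (a <= b)%N -> (A : 'M[R]_k) a b =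
    ((\sum_(p : sym_index k) frob A (sym_basis R p) *: sym_basis R p : symM R k)
      : 'M[R]_k) a b.
  move=> ab; rewrite symM_sumE; pose p : sym_index k := exist _ (a, b) ab.
  rewrite (bigD1 p)//= big1 => [|p' pp'].
    rewrite mxE sym_basis_entry// eqxx mul1r frob_sym_basis /= addr0.
    case: eqVneq => _; first by rewrite mulr1.
    by rewrite mulrAC divff ?mul1r// sqrtr_eq0 -ltNge.
  rewrite mxE sym_basis_entry// (_ : (val p' == (a, b)) = false) ?mul0r ?mulr0//.
  by apply: negbTE; apply: contra pp' => /eqP e; apply/eqP/val_inj.
apply/val_inj/matrixP => a b; have [/ltnW ab|ab] := ltnP a b; first exact: upper.
by rewrite symM_entryC [RHS]symM_entryC; exact: upper.
Qed.

Definition sym_basis_ord (i : 'I_#|{: sym_index k}|) : symM R k :=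
  sym_basis R (enum_val i).

Lemma symM_euclidean : euclidean_basis (@frob R k) sym_basis_ord.
Proof.
split=> [|||i j|A]; [exact: frobC|exact: frobDl|exact: frobZl| |].
  by rewrite sym_basis_orthonormal (inj_eq enum_val_inj).
rewrite [LHS]sym_basis_span [RHS](reindex enum_rank) /sym_basis_ord.
  by apply: eq_bigr => p _; rewrite enum_rankK.
by apply: onW_bij; exact: enum_rank_bij.
Qed.

End symM_basis.

Section param_basis.
Context {R : realType}.

Definition cdot d (a b : 'cV[R]_d) : R := (a^T *m b) 0 0.

Lemma cdotE d (a b : 'cV[R]_d) : cdot a b = \sum_i a i 0 * b i 0.
Proof. by rewrite /cdot mxE; apply: eq_bigr => i _; rewrite mxE. Qed.

Lemma cV_euclidean d : euclidean_basis (@cdot d) (fun i => delta_mx i 0).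
Proof.
have dotd (x : 'cV[R]_d) i : cdot x (delta_mx i 0) = x i 0.
  rewrite cdotE (bigD1 i)//= big1 => [|j ji].
    by rewrite mxE !eqxx mulr1 addr0.
  by rewrite mxE (negbTE ji) mulr0.
split=> [x y|x y z|a x y|i j|x].
- by rewrite !cdotE; apply: eq_bigr => i _; rewrite mulrC.
- by rewrite /cdot linearD /= mulmxDl mxE.
- by rewrite /cdot linearZ /= -scalemxAl mxE.
- by rewrite dotd mxE eqxx andbT eq_sym.
- rewrite {1}[x]matrix_sum_delta; apply: eq_bigr => i _.
  by rewrite big_ord1 dotd.
Qed.

Lemma pdotE d q (x y : param R d q) : pdot x y = cdot x.1 y.1 + frob x.2 y.2.
Proof. by []. Qed.

Lemma param_euclidean d q : exists N (e : 'I_N -> param R d q),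
  euclidean_basis (@pdot R d q) e.
Proof.
pose e (i : 'I_(d + #|{: sym_index q}|)) : param R d q :=
  match fintype.split i with
  | inl j => mkparam (delta_mx j 0) 0
  | inr j => mkparam 0 (sym_basis_ord j)
  end.
exists _, e; have cb := cV_euclidean d; have sb := @symM_euclidean R q.
have el j : e (lshift _ j) = mkparam (delta_mx j 0) 0.
  by rewrite /e (unsplitK (inl j)).
have er j : e (rshift _ j) = mkparam 0 (sym_basis_ord j).
  by rewrite /e (unsplitK (inr j)).
split=> [|||i j|x]; [exact: pdotC|exact: pdotDl|exact: pdotZl| |].
  rewrite -(splitK i) -(splitK j) pdotE.
  case: (fintype.split i) => {}i; case: (fintype.split j) => {}j /=; rewrite ?el ?er /=.
  - by rewrite (dot_basis cb) (dot0l sb) addr0 (inj_eq (@lshift_inj _ _)).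
  - by rewrite (dot0l sb) (dot0r cb) addr0 eq_lrshift.
  - by rewrite (dot0r sb) (dot0l cb) addr0 eq_rlshift.
  - by rewrite (dot_basis sb) (dot0l cb) add0r (inj_eq (@rshift_inj _ _)).
rewrite big_split_ord /=.
under eq_bigr do rewrite el pdotE /= (dot0r sb) addr0.
under [X in _ + X]eq_bigr do rewrite er pdotE /= (dot0r cb) add0r.
case: x => a A /=.
have fstE I (r : seq I) (F : I -> param R d q) :
    (\sum_(i <- r) F i).1 = \sum_(i <- r) (F i).1.
  exact: (big_morph (fun x : param R d q => x.1)).
have sndE I (r : seq I) (F : I -> param R d q) :
    (\sum_(i <- r) F i).2 = \sum_(i <- r) (F i).2.
  exact: (big_morph (fun x : param R d q => x.2)).
rewrite [LHS]surjective_pairing [RHS]surjective_pairing /= !fstE !sndE /=.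
congr pair.
  rewrite [X in _ + X]big1 ?addr0 => [|i _]; last by rewrite scaler0.
  exact: (dot_span cb).
rewrite [X in X + _]big1 ?add0r => [|i _]; last by rewrite scaler0.
exact: (dot_span sb).
Qed.

End param_basis.

Lemma continuous_sum (R : numFieldType) (V : normedModType R)
    (T : topologicalType) (I : Type) (r : seq I) (f : I -> T -> V) :
  (forall i, continuous (f i)) -> continuous (fun x => \sum_(i <- r) f i x).
Proof.
move=> cf; elim: r => [|i r IH].
  rewrite (_ : (fun _ => _) = cst 0); first exact: cst_continuous.
  by apply/funext => x; rewrite big_nil.
rewrite (_ : (fun _ => _) = f i \+ (fun x => \sum_(j <- r) f j x)).
  by move=> x; apply: cvgD; [exact: cf|exact: IH].
by apply/funext => x; rewrite big_cons.
Qed.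

Section euclidean_topology.
Context {R : realType} {V : normedModType R} {dot : V -> V -> R} {N : nat}.
Context {e : 'I_N -> V} (eb : euclidean_basis dot e).
Hypothesis normE : forall x : V, `|x| = Num.sqrt (dot x x).

Lemma euclidean_normsq x : `|x| ^+ 2 = dot x x.
Proof. by rewrite normE sqr_sqrtr ?(dot_self_ge0 eb). Qed.

Lemma ler_dot_norm x y : `|dot x y| <= `|x| * `|y|.
Proof.
rewrite -(@ler_pXn2r _ 2)// ?nnegrE ?mulr_ge0// exprMn !euclidean_normsq.
rewrite -normrX ger0_norm ?sqr_ge0//.
apply: dot_cauchy_schwarz; [exact: (dot_sym eb)|exact: (dot_addl eb)|
  exact: (dot_scalel eb)|exact: (dot_self_ge0 eb)|].
by move=> z z0; apply/eqP; rewrite -normr_eq0 normE z0 sqrtr0.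
Qed.

Lemma continuous_dot y : continuous (fun x => dot x y).
Proof.
have lin : linear (fun x => dot x y : R^o).
  by move=> a u v; rewrite (dot_addl eb) (dot_scalel eb).
pose L : {linear V -> R^o} := HB.pack (fun x => dot x y : R^o)
  (GRing.isLinear.Build _ _ _ _ _ lin).
apply: (@bounded_linear_continuous _ _ _ L).
apply/linear_boundedP; exists (`|y|); split=> // r ry x.
rewrite (le_trans (ler_dot_norm x y))// mulrC.
by apply: ler_wpM2r => //; exact: ltW.
Qed.

Lemma continuous_euclidean_linear (V' : normedModType R) (f : V -> V') :
  linear f -> continuous f.
Proof.
move=> lf.
pose L : {linear V -> V'} := HB.pack f (GRing.isLinear.Build _ _ _ _ f lf).
have -> : f = fun x => \sum_i dot x (e i) *: f (e i).
  apply/funext => x; rewrite {1}(dot_span eb x) -[LHS]/(L _) linear_sum.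
  by apply: eq_bigr => i _; rewrite linearZ.
apply: continuous_sum => i x; apply: cvgZr_tmp; exact: continuous_dot.
Qed.

Lemma continuous_of_coords : continuous (of_coords (e := e)).
Proof.
apply: continuous_sum => i a.
exact: (cvgZr_tmp (@coord_continuous R N 1 i 0 a)).
Qed.

Lemma ball_subset_compact (M : R) :
  exists2 C : set V, compact C & forall x, `|x| <= M -> C x.
Proof.
pose A := [set v : 'rV[R]_N | forall i, `[- M, M]%classic (v ord0 i)].
have cA : compact A.
  by apply: (@rV_compact R N (fun=> `[- M, M]%classic)) => i; exact: segment_compact.
exists ((fun v : 'rV_N => of_coords (e := e) v^T) @` A).
  apply: continuous_compact => //; apply: continuous_subspaceT.
  apply: continuous_sum => i.
  rewrite (_ : (fun _ => _) = (fun v : 'rV[R]_N => v 0 i *: e i)).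
    by move=> v; exact: (cvgZr_tmp (@coord_continuous R 1 N 0 i v)).
  by apply/funext => v; rewrite mxE.
move=> x xM; exists (coords (dot := dot) (e := e) x)^T; last by rewrite trmxK (coordsK eb).
move=> i; rewrite !mxE /= in_itv /= -ler_norml.
rewrite (le_trans (ler_dot_norm _ _))// [`|e i|]normE (dot_basis eb) eqxx sqrtr1 mulr1//.
Qed.

Lemma linear_bounded (V' : normedModType R) (f : V -> V') : linear f ->
  exists2 c : R, 0 < c & forall x, `|f x| <= c * `|x|.
Proof.
move=> lf.
pose L : {linear V -> V'} := HB.pack f (GRing.isLinear.Build _ _ _ _ f lf).
exists (1 + \sum_i `|f (e i)|); first by rewrite ltr_wpDr// sumr_ge0.
move=> x; rewrite {1}(dot_span eb x) -[f _]/(L _) linear_sum.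
rewrite (le_trans (ler_norm_sum _ _ _))// mulrDl mul1r ler_wpDl// mulr_suml.
apply: ler_sum => i _; rewrite linearZ normrZ mulrC; apply: ler_wpM2l => //.
rewrite (le_trans (ler_dot_norm _ _))// [`|e i|]normE (dot_basis eb) eqxx sqrtr1.
by rewrite mulr1.
Qed.

(** Coercivity without compactness: Cauchy-Schwarz in the [J] inner product bounds
    [|x|^4] by [dot x (J x) * dot x (J^-1 x)], and [J^-1] is bounded. *)
Lemma posdef_coercive (J : V -> V) : posdef_operator dot J ->
  exists2 c : R, 0 < c & forall x, `|x| ^+ 2 <= c * dot x (J x).
Proof.
move=> Jpos; have Jipos := posdef_inv eb Jpos.
have JiK := op_invK eb Jpos; have [_ _ Jp] := Jpos.
have Jilin : linear (op_inv J) by case: Jipos.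
have [c c0 Jic] := linear_bounded Jilin.
exists c => // x.
have [->|x0] := eqVneq x 0; first by rewrite normr0 (dot0l eb) expr0n mulr0.
have cs := posdef_cauchy_schwarz eb Jpos x (op_inv J x).
rewrite JiK -euclidean_normsq in cs.
have xx : 0 < `|x| ^+ 2 by rewrite exprn_gt0// normr_gt0.
have ix : dot (op_inv J x) x <= c * `|x| ^+ 2.
  rewrite (le_trans (ler_norm _))// (le_trans (ler_dot_norm _ _))// expr2 mulrA.
  exact: ler_wpM2r.
rewrite -(ler_pM2r xx) -expr2 (le_trans cs)//.
by rewrite (le_trans (ler_wpM2l (ltW (Jp _ x0)) ix))// mulrA (mulrC c).
Qed.

End euclidean_topology.

(** * The active block of the information operator *)

Section active_block_operators.
Context {R : realType} {d q k : nat}.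
Variables (J : param R d q -> param R d q) (U : 'M[R]_(q, k)).
Hypothesis Jpos : posdef_operator (@pdot R d q) J.
Hypothesis UU : U^T *m U = 1%:M.

Definition active (h : param R d q) : symM R k := congr_sym U h.2.
Definition active_adj (B : symM R k) : param R d q := mkparam 0 (congr_sym U^T B).

Lemma congr_sym_linear q' k' (M : 'M[R]_(q', k')) : linear (congr_sym (R := R) M).
Proof.
move=> a A B; apply/val_inj => /=.
by rewrite mulmxDr mulmxDl -scalemxAr -scalemxAl.
Qed.

Lemma active_linear : linear active.
Proof. by move=> a x y; rewrite /active -congr_sym_linear. Qed.

Lemma active_adjE h B : frob (active h) B = pdot h (active_adj B).
Proof.
rewrite pdotE /= (dot0r (cV_euclidean _)) add0r /frob /= trmxK.
by rewrite -!mulmxA mxtrace_mulC !mulmxA.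
Qed.

Let JD x y : J (x + y) = J x + J y.
Proof. by case: Jpos => Jl _ _; have := Jl 1 x y; rewrite !scale1r. Qed.

Let pairD (a b : 'cV[R]_d) (A B : symM R q) :
  mkparam a A + mkparam b B = mkparam (a + b) (A + B).
Proof. by []. Qed.

Let Jpp a := (J (mkparam a 0)).1.

(** The nuisance block inherits positivity, so the inverse that occurs in the
    effective information is a genuine one. *)
Lemma nuisance_info_posdef : posdef_operator (@cdot R d) Jpp.
Proof.
have Jppq a b : cdot a (Jpp b) = pdot (mkparam a 0) (J (mkparam b 0)).
  by rewrite pdotE /= (dot0l (@symM_euclidean R q)) addr0.
split=> [c a b|a b|a a0].
- rewrite /Jpp; have -> : mkparam (c *: a + b) (0 : symM R q) = c *: mkparam a 0 + mkparam b 0.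
    by apply: (congr2 pair) => //=; rewrite scaler0 addr0.
  by case: Jpos => -> _ _.
- rewrite (dot_sym (cV_euclidean d)) !Jppq pdotC.
  by case: Jpos => _ -> _.
- rewrite Jppq; case: Jpos => _ _; apply; apply: contra a0 => /eqP[->] //.
Qed.

(** Block inversion: the inverse of the Schur complement is the corresponding
    block of the inverse. [profile] solves the nuisance equation, so that [J]
    maps it to a vector without nuisance component. *)
Lemma eff_info_inv H : op_inv (eff_info J) H = (op_inv J (mkparam 0 H)).2.
Proof.
have [N [e eb]] := param_euclidean (R := R) d q.
have ppK := op_invK (cV_euclidean d) nuisance_info_posdef.
have ppE := op_invE (cV_euclidean d) nuisance_info_posdef.
pose profile G := mkparam (- op_inv Jpp (J (mkparam 0 G)).1) G.
have profileE G : J (profile G) = mkparam 0 (eff_info J G).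
  have Jsplit : profile G = (-1) *: mkparam (op_inv Jpp (J (mkparam 0 G)).1) 0 + mkparam 0 G.
    by apply: (congr2 pair) => /=; rewrite ?scaleN1r ?addr0 ?oppr0 ?add0r.
  case: (Jpos) => Jl _ _; rewrite Jsplit Jl scaleN1r.
  apply: (congr2 pair) => /=.
    by have := ppK (J (mkparam 0 G)).1; rewrite /Jpp => ->; rewrite addNr.
  by rewrite addrC.
rewrite {1}/op_inv; case: xgetP => [G _ <-|none].
  by rewrite -profileE (op_invE eb Jpos (erefl _)).
have := op_invK eb Jpos (mkparam 0 H).
case: (op_inv J (mkparam 0 H)) => a G JaG.
suff eG : eff_info J G = H by case: (none G).
have aE : a = - op_inv Jpp (J (mkparam 0 G)).1.
  apply/eqP; rewrite -[a]opprK eqr_opp; apply/eqP/esym/ppE.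
  have : J (mkparam a G) = J (mkparam a 0) + J (mkparam 0 G).
    by rewrite -JD pairD addr0 add0r.
  rewrite JaG => /(congr1 fst) /= JaJG.
  have [ppl _ _] := nuisance_info_posdef.
  have pp0 : Jpp 0 = 0 by have := ppl (-1) 0 0; rewrite scaler0 addr0 scaleN1r addNr.
  have := ppl (-1) a 0; rewrite pp0 !addr0 !scaleN1r => ->.
  by apply/eqP; rewrite eq_sym -addr_eq0 addrC; apply/eqP/esym.
have := profileE G; rewrite /profile -aE JaG => /(congr1 snd) /= //.
Qed.

(** Hence the reduced covariance is the compression of [J^-1] by [active], as
    the quadratic programme requires. *)
Lemma reduced_covE B : reduced_cov J U B = active (op_inv J (active_adj B)).
Proof. by rewrite /reduced_cov eff_info_inv. Qed.

Lemma reduced_cov_posdef : posdef_operator (@frob R k) (reduced_cov J U).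
Proof.
have [N [e eb]] := param_euclidean (R := R) d q.
have [Jil Jis Jip] := posdef_inv eb Jpos.
have adj_lin : linear active_adj.
  move=> a x y; rewrite /active_adj congr_sym_linear.
  by apply: (congr2 pair) => //=; rewrite scaler0 addr0.
split=> [a x y|x y|x x0].
- by rewrite !reduced_covE adj_lin Jil active_linear.
- by rewrite !reduced_covE active_adjE Jis [RHS]frobC active_adjE pdotC.
- rewrite reduced_covE frobC active_adjE pdotC; apply: Jip.
  apply: contra x0 => /eqP/(congr1 active).
  rewrite /active /active_adj /= => /(congr1 val) /=.
  rewrite !trmxK !mulmxA UU mul1mx -mulmxA UU mulmx1 mulmx0 mul0mx => x0.
  by apply/eqP/val_inj.
Qed.

Definition white : param R d q -> symM R k :=
  whiten (dW := @frob R k) J active (reduced_cov J U).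

(** The coordinates of [white (Z w)] in the orthonormal basis are combinations of
    the underlying normal variables, with a coefficient matrix whose rows are
    orthonormal by [whiten_cov]; so they are again independent standard normal. *)
Lemma white_gaussian_law (dY dZ : measure_display) (TY : measurableType dY)
    (TZ : measurableType dZ) (Q : probability TY R) (QZ : probability TZ R)
    (Y : TY -> symM R k) (Z : TZ -> param R d q) (psi : symM R k -> R) (B : set R) :
  standard_gaussian Q Y -> centered_gaussian QZ J Z -> continuous psi ->
  measurable B ->
  Q [set w | B (psi (Y w))] = QZ [set w | B (psi (white (Z w)))].
Proof.
move=> gY [m [L [G [Llin iG ZE covL]]]] cpsi mB.
have [N [e eb]] := param_euclidean (R := R) d q.
have sb := @symM_euclidean R k.
have Spos := reduced_cov_posdef.
pose adj y := whiten_adj (dW := @frob R k) J active_adj (reduced_cov J U) y.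
have wadj z y : frob (white z) y = pdot z (adj y).
  exact: (whiten_adjE eb sb Jpos active_adjE Spos).
pose M := \matrix_(p < #|{: sym_index k}|, i < m)
  pdot (L (delta_mx i 0)) (adj (sym_basis_ord p)).
have MM : M *m M^T = 1%:M.
  apply/matrixP => p p'; rewrite !mxE -(dot_basis sb).
  rewrite -(whiten_cov eb sb Jpos active_adjE Spos reduced_covE) covL.
  apply: eq_bigr => i _; rewrite !mxE.
  by congr (_ * _); exact: pdotC.
have iMG := iid_orthonormal_rows MM iG.
have iH := iid_subfamily (@enum_rank_inj {: sym_index k}) iMG.
pose ofc : 'cV[R]_#|{: sym_index k}| -> symM R k := of_coords (e := @sym_basis_ord R k).
have YE w : Y w = ofc (\col_i frob (Y w) (sym_basis R (enum_val i))).
  rewrite [LHS](dot_span sb); apply: eq_bigr => i _; rewrite mxE //.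
have ZE' w : white (Z w) =
    ofc (\col_i (lincomb M G \o enum_rank) (enum_val i) w).
  rewrite [LHS](dot_span sb); apply: eq_bigr => i _; rewrite mxE /= enum_valK.
  congr (_ *: _); rewrite wadj ZE /lincomb.
  rewrite [X in pdot X _](_ : _ = \sum_j G j w *: L (delta_mx j 0)).
    rewrite (dot_suml eb); apply: eq_bigr => j _.
    by rewrite (dot_scalel eb) mxE mulrC.
  pose LL : {linear 'cV[R]_m -> param R d q} := HB.pack L
    (GRing.isLinear.Build _ _ _ _ L Llin).
  rewrite -[L _]/(LL _) [X in LL X]matrix_sum_delta linear_sum.
  by apply: eq_bigr => j _; rewrite big_ord1 linearZ /= mxE.
under eq_set do rewrite YE; under [in RHS]eq_set do rewrite ZE'.
apply: (iid_law_continuous (phi := psi \o ofc) gY iH) => //.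
move=> a; apply: continuous_comp; last exact: cpsi.
exact: (continuous_of_coords).
Qed.

End active_block_operators.

(** * Outer expectations and convergence in law *)

Section outer_probability.
Context {R : realType} {d : measure_display} {T : measurableType d}
  (P : probability T R).
Local Open Scope ereal_scope.

Lemma mu_ext_cover (A : set T) (delta : R) : mu_ext P A < delta%:E ->
  exists2 C, measurable C & A `<=` C /\ P C < delta%:E.
Proof.
move=> /ereal_inf_lt[_ [B [mB AB] <-] Bdelta].
exists (\bigcup_k B k); first exact: bigcupT_measurable.
split=> //; apply: le_lt_trans Bdelta.
by apply: measure_sigma_subadditive => //; exact: bigcupT_measurable.
Qed.

Lemma mu_extU (A B : set T) : mu_ext P (A `|` B) <= mu_ext P A + mu_ext P B.
Proof. exact: outer_measureU2. Qed.

End outer_probability.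

Section outer_expectation_lemmas.
Context {R : realType} {dT : nat -> measure_display}
  {T : forall n, measurableType (dT n)} (P : forall n, probability (T n) R).
Local Open Scope ereal_scope.

Lemma outer_expectation_le n (g u : T n -> R) :
  (P n).-integrable setT (EFin \o u) -> (forall w, g w <= u w)%R ->
  outer_expectation P g <= \int[P n]_w (u w)%:E.
Proof.
move=> iu gu; apply: ereal_inf_lbound; exists u => //.
by rewrite unlock.
Qed.

Lemma le_outer_expectation n (g : T n -> R) (c : \bar R) :
  (forall u : T n -> R, (P n).-integrable setT (EFin \o u) ->
    (forall w, g w <= u w)%R -> c <= \int[P n]_w (u w)%:E) ->
  c <= outer_expectation P g.
Proof.
move=> gc; apply: le_ereal_inf_tmp => _ [u [iu gu] <-].
by rewrite unlock; exact: gc.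
Qed.

Lemma integral_prob_cst n (c : R) : \int[P n]_w (cst c%:E) w = c%:E.
Proof.
rewrite integral_cst//; transitivity (c%:E * 1); last by rewrite mule1.
congr (_ * _); exact: probability_setT.
Qed.

Lemma integrable_prob_cst n (c : R) : (P n).-integrable setT (cst c%:E).
Proof.
by apply: finite_measure_integrable_cst.
Qed.

Lemma outer_expectation_fin n (g : T n -> R) (M : R) :
  (forall w, `|g w| <= M)%R -> outer_expectation P g \is a fin_num.
Proof.
move=> gM; rewrite fin_numElt; apply/andP; split.
  apply: (@lt_le_trans _ _ (- M)%:E); first exact: ltNyr.
  apply: le_outer_expectation => u iu gu.
  rewrite -(integral_prob_cst n).
  apply: le_integral => //; first exact: integrable_prob_cst.
  move=> w _; rewrite lee_fin; apply: le_trans (gu w).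
  by have := gM w; rewrite ler_norml => /andP[].
apply: (@le_lt_trans _ _ M%:E); last exact: ltry.
apply: (le_trans (@outer_expectation_le n g (cst M) _ _)).
- exact: integrable_prob_cst.
- by move=> w; rewrite (le_trans (ler_norm _))//.
- by rewrite integral_prob_cst.
Qed.

(** The exceptional set is enclosed in a measurable set [C] of probability below
    [delta]. On [C] the two functions differ by at most [2 * M], so adding
    [eta + 2 * M * \1_C] to a majorant of [g'] gives one of [g]. *)
Lemma outer_expectation_compare n (g g' : T n -> R) (M eta delta : R) :
  (forall w, `|g w| <= M)%R -> (forall w, `|g' w| <= M)%R ->
  (0 <= eta)%R -> 
  mu_ext (P n) [set w | (g' w + eta < g w)%R] < delta%:E ->
  outer_expectation P g <= outer_expectation P g' + (eta + 2 * M * delta)%:E.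
Proof.
move=> gM g'M eta0 /mu_ext_cover[C mC [badC PC]].
have M0 : (0 <= M)%R.
  have [w _] : [set: T n] !=set0.
    apply/set0P/negP => /eqP T0; have := probability_setT (P n).
    by rewrite T0 measure0 => /eqP; rewrite eq_sym onee_eq0.
  exact: le_trans (gM w).
rewrite -leeBlDr//; apply: le_outer_expectation => u' iu' gu'; rewrite leeBlDr//.
pose h w := (eta + 2 * M * \1_C w)%R.
have ih1 : (P n).-integrable setT (fun w => (2 * M * \1_C w)%:E).
  apply: (eq_integrable measurableT (fun w => (2 * M)%:E * (\1_C w)%:E)).
    by move=> w _; rewrite EFinM.
  by apply: integrableZl => //; exact: integrable_indic.
have ih : (P n).-integrable setT (EFin \o h).
  apply: (eq_integrable measurableT (cst eta%:E \+ (fun w => (2 * M * \1_C w)%:E))).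
    by move=> w _; rewrite /= EFinD.
  by apply: integrableD => //; exact: integrable_prob_cst.
apply: (le_trans (@outer_expectation_le n g (fun w => u' w + h w)%R _ _)).
- apply: (eq_integrable measurableT ((EFin \o u') \+ (EFin \o h))).
    by move=> w _; rewrite /= EFinD.
  exact: integrableD.
- move=> w; rewrite /h indicE; case: (boolP (w \in C)) => [_|].
    rewrite mulr1; have := gM w; have := g'M w; have := gu' w.
    by rewrite !ler_norml => ? /andP[? ?] /andP[? ?]; lra.
  rewrite notin_setE mulr0 addr0 => Cw.
  have : ~ (g' w + eta < g w)%R by move=> bad; apply: Cw; exact: badC.
  by move=> /negP; rewrite -leNgt => /le_trans; apply; rewrite lerD2r.
- under eq_integral do rewrite EFinD.
  rewrite integralD//= leeD2l//.
  under eq_integral do rewrite EFinD.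
  rewrite integralD//=; last exact: integrable_prob_cst.
  rewrite integral_prob_cst EFinD leeD2l//.
  under eq_integral do rewrite EFinM.
  rewrite integralZl//; last exact: integrable_indic.
  rewrite integral_indic// setIT [leRHS]EFinM lee_wpmul2l ?lee_fin ?mulr_ge0//.
  exact: ltW.
Qed.

Lemma outer_expectation_cvg (g g' : forall n, T n -> R) (M : R) (l : \bar R) :
  (forall n w, `|g n w| <= M)%R -> (forall n w, `|g' n w| <= M)%R ->
  (forall e : R, (0 < e)%R -> \forall n \near \oo,
    mu_ext (P n) [set w | (e < `|g n w - g' n w|)%R] < e%:E) ->
  outer_expectation P (g' n) @[n --> \oo] --> l ->
  outer_expectation P (g n) @[n --> \oo] --> l.
Proof.
move=> gM g'M close cg'.
pose x n := fine (outer_expectation P (g n)).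
pose y n := fine (outer_expectation P (g' n)).
have xE n : outer_expectation P (g n) = (x n)%:E.
  by rewrite fineK// (outer_expectation_fin (gM n)).
have yE n : outer_expectation P (g' n) = (y n)%:E.
  by rewrite fineK// (outer_expectation_fin (g'M n)).
have xy0 : (x n - y n)%R @[n --> \oo] --> 0%R.
  apply/cvgrPdist_le => e e0; rewrite /=.
  have M2 : (0 < 1 + 2 * `|M|)%R by rewrite ltr_wpDr// mulr_ge0.
  pose e' := (e / (1 + 2 * `|M|))%R.
  have e'0 : (0 < e')%R by rewrite divr_gt0.
  have bound : (e' + 2 * M * e' <= e)%R.
    rewrite (_ : e' + _ = (1 + 2 * M) * e')%R; last by ring.
    rewrite /e' mulrA ler_pdivrMr// mulrC ler_pM2l// lerD2l ler_pM2l//.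
    exact: ler_norm.
  apply: filterS (close _ e'0) => n bad; rewrite sub0r normrN.
  have half (u v : T n -> R) : (forall w, `|u w| <= M)%R ->
      (forall w, `|v w| <= M)%R -> (forall w, `|u w - v w| = `|g n w - g' n w|)%R ->
      outer_expectation P u <= outer_expectation P v + e%:E.
    move=> uM vM uv; apply: (le_trans (@outer_expectation_compare _ _ _ M e' e' uM vM (ltW e'0) _)).
      apply: le_lt_trans bad; apply: le_mu_ext => w /= uvw.
      by rewrite -uv (lt_le_trans _ (ler_norm _))// ltrBrDl.
    by rewrite leeD2l// lee_fin.
  have := half _ _ (gM n) (g'M n) (fun=> erefl).
  have := half _ _ (g'M n) (gM n) (fun w => distrC _ _).
  by rewrite xE yE -!EFinD !lee_fin ler_norml => ? ?; apply/andP; split; lra.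
have -> : (fun n => outer_expectation P (g n)) =
    (fun n => outer_expectation P (g' n) + (x n - y n)%:E).
  by apply/funext => n; rewrite xE yE -EFinD addrC subrK.
rewrite -[X in _ --> X]adde0; apply: cvgeD => //.
  by rewrite fin_num_adde_defl.
by apply: cvg_EFin => //; exact: nearW.
Qed.

Lemma mu_ext_le_outer_expectation n (g : T n -> R) (A : set (T n)) :
  (forall w, 0 <= g w)%R -> (forall w, A w -> 1 <= g w)%R ->
  mu_ext (P n) A <= outer_expectation P g.
Proof.
move=> g0 gA; apply: le_outer_expectation => u iu gu.
have mu_ : measurable_fun setT u by move/integrableP : iu => [/measurable_EFinP].
have mC : measurable [set w | (1 <= u w)%R].
  rewrite (_ : mkset _ = u @^-1` `[1%R, +oo[).
    by rewrite -[X in measurable X]setTI; exact: mu_.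
  by apply/seteqP; split=> w /=; rewrite in_itv/= andbT.
apply: (@le_trans _ _ (P n [set w | (1 <= u w)%R])).
  rewrite -measurable_mu_extE//; apply: le_mu_ext => w /gA /le_trans; apply.
  exact: gu.
rewrite -[leLHS](_ : \int[P n]_w (\1_[set w | (1 <= u w)%R] w)%:E = _); last first.
  by rewrite integral_indic// setIT.
apply: le_integral => //; first exact: integrable_indic.
move=> w _; rewrite lee_fin indicE; case: (boolP (w \in _)) => [|_].
  by rewrite inE.
exact: le_trans (gu w).
Qed.

Section convergence_in_law.
Context {V : normedModType R} (Zn : forall n, T n -> V)
  {d : measure_display} {W : measurableType d} (Q : probability W R) (Z : W -> V).
Hypothesis ZnZ : cvg_in_law P Zn Q Z.
Hypothesis mZ : measurable_fun setT (fun w => `|Z w|%R).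

Let ramp (m : nat) (x : R) : R := Num.min 1%R (Num.max 0%R (x - m%:R)%R).

Let ramp01 m x : (0 <= ramp m x <= 1)%R.
Proof. by rewrite /ramp le_min ler01 le_max lexx ge_min lexx. Qed.

Let continuous_ramp m : continuous (ramp m).
Proof.
have -> : ramp m = (cst 1%R : R -> R^o) \min ((cst 0%R : R -> R^o) \max (fun y => y - m%:R)%R).
  by [].
move=> x; apply: continuous_min; first exact: cvg_cst.
apply: continuous_max; first exact: cvg_cst.
by apply: cvgB => //; exact: cvg_cst.
Qed.

(** Prohorov's easy half: the expectation of [ramp m `|Z|] tends to 0 with [m], and
    for fixed [m] the outer expectations along the sequence converge to it. *)
Lemma tight_of_cvg_in_law (eps : R) : (0 < eps)%R -> exists M : R,
  \forall n \near \oo, mu_ext (P n) [set w | (M < `|@Zn n w|)%R] < eps%:E.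
Proof.
move=> eps0.
have mramp m : measurable_fun setT (fun w => ramp m `|Z w|).
  by apply: measurableT_comp => //; apply: continuous_measurable_fun; exact: continuous_ramp.
have : \int[Q]_w (ramp m `|Z w|)%:E @[m --> \oo] --> \int[Q]_w (cst 0 w).
  apply: (@dominated_cvg _ _ _ Q setT measurableT _ _ (cst 1%:E)) => //.
  - by move=> m; apply/measurable_EFinP; exact: mramp.
  - move=> w _; apply: cvg_near_cst; near=> m.
    rewrite /ramp max_l ?min_r//= subr_le0.
    by near: m; exact: nbhs_infty_ger.
  - exact: finite_measure_integrable_cst.
  - move=> m w _; have /andP[r0 r1] := ramp01 m `|Z w|.
    by rewrite /= lee_fin ger0_norm.
rewrite integral0 => /fine_cvgP[ifin /cvgrPdist_lt/(_ _ eps0)] close.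
have [m [mfin mclose]] : exists m, (\int[Q]_w (ramp m `|Z w|)%:E \is a fin_num) /\
    (\int[Q]_w (ramp m `|Z w|)%:E < eps%:E).
  have [m [fm cm]] := filter_ex (filterI ifin close); exists m; split=> //.
  by rewrite -(fineK fm) lte_fin; move: cm; rewrite /= sub0r normrN => /(le_lt_trans (ler_norm _)).
exists (m%:R + 1)%R.
have cf : continuous (fun x : V => ramp m `|x|).
  move=> x; apply: continuous_comp; first exact: norm_continuous.
  exact: continuous_ramp.
have bf : exists M : R, forall x : V, (`|ramp m `|x| | <= M)%R.
  by exists 1%R => x; have /andP[r0 r1] := ramp01 m `|x|; rewrite ger0_norm.
have := ZnZ cf bf; rewrite unlock => cvgE.
move: cvgE; rewrite /comp -(fineK mfin) => /fine_cvgP[ofin ocvg].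
have m_lt : (fine (\int[Q]_w (ramp m `|Z w|)%:E) < eps)%R by rewrite -lte_fin fineK.
apply: filterS2 ofin (cvgr_lt _ ocvg _ m_lt) => n nfin nlt.
apply: (@le_lt_trans _ _ (outer_expectation P (fun w => ramp m `|@Zn n w|)));
  last first.
  by rewrite -(fineK nfin) lte_fin.
apply: mu_ext_le_outer_expectation => w.
  by have /andP[] := ramp01 m `|@Zn n w|.
by move=> /= mw; rewrite /ramp le_min lexx le_max lerBrDl (ltW mw) orbT.
Unshelve. all: by end_near. Qed.

Lemma uniform_continuity_on_compact (K : set R) (f : R -> R) (e : R) :
  compact K -> continuous f -> (0 < e)%R -> exists2 delta : R, (0 < delta)%R &
    forall x y : R, K x -> (`|y - x| <= delta -> `|f y - f x| <= e)%R.
Proof.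
move=> cK cf e0.
have : \forall delta \near (0%R : R)^'+, K `<=` [set x : R | forall y : R,
    (`|y - x| <= delta -> `|f y - f x| <= e)%R].
  apply: (proj1 (compact_near_coveringP K) cK) => x Kx.
  have e2 : (0 < e / 2)%R by rewrite divr_gt0.
  have /cvgrPdist_le/(_ _ e2) /nbhs_ballP[r /= r0 fr] := cf x.
  have r2 : (0 < r / 2)%R by rewrite divr_gt0.
  exists (ball x (r / 2), [set delta : R | (delta < r / 2)%R]).
    split; first exact: nbhsx_ballx.
    exact: nbhs_right_lt.
  move=> [x' delta] /= [xx' dr] y yx'; rewrite /ball_ /= in xx'.
  have fx' : (`|f x - f x'| <= e / 2)%R.
    by apply: fr; move: xx'; rewrite /ball /= => xx'; lra.
  have fy : (`|f x - f y| <= e / 2)%R.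
    apply: fr; rewrite /ball /= (_ : x - y = (x - x') + (x' - y))%R; last by ring.
    rewrite (splitr r) (le_lt_trans (ler_normD _ _))// ltr_leD//.
    by rewrite distrC (le_trans yx')// ltW.
  rewrite (_ : f y - f x' = (f x - f x') - (f x - f y))%R; last by ring.
  by rewrite (le_trans (ler_normB _ _))// (splitr e) lerD.
move=> H.
have [delta [Kdelta d0]] := filter_ex (filterI H (nbhs_right_gt (0 : R)%R)).
by exists delta => // x y Kx; exact: Kdelta.
Qed.

(** Continuous mapping and Slutsky in one step. Tightness confines [Zn] to a
    compact set, where [f \o EFin] is uniformly continuous on the image of [phi]. *)
Lemma cvg_in_law_of_close (phi : V -> R) (X : forall n, T n -> \bar R)
    (f : \bar R -> R) :
  (forall M : R, exists2 C : set V, compact C & forall x, (`|x| <= M)%R -> C x) ->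
  continuous phi ->
  (forall e : R, (0 < e)%R -> \forall n \near \oo, mu_ext (P n)
    [set w | ~ exists2 l : R, X n w = l%:E & (`|l - phi (@Zn n w)| <= e)%R] < e%:E) ->
  continuous f -> (exists M : R, forall x, (`|f x| <= M)%R) ->
  outer_expectation P (fun w => f (X n w)) @[n --> \oo] -->
    \int[Q]_w (f (phi (Z w))%:E)%:E.
Proof.
move=> balls cphi close cf [M fM].
have cfE : continuous (f \o EFin).
  by move=> x; apply: continuous_comp; [by apply: cvg_EFin; [exact: nearW|exact: cvg_id]|exact: cf].
apply: (@outer_expectation_cvg _ (fun n w => f (phi (@Zn n w))%:E) M) => //; last first.
  have := @ZnZ (fun z => f (phi z)%:E); rewrite unlock; apply.
    by move=> z; apply: (@continuous_comp _ _ _ phi (f \o EFin)); [exact: cphi|exact: cfE].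
  by exists M.
move=> e e0.
have e2 : (0 < e / 2)%R by rewrite divr_gt0.
have [M' tight] := tight_of_cvg_in_law e2.
have [C cC ballC] := balls M'.
have cphiC : compact (phi @` C).
  by apply: continuous_compact => //; exact: continuous_subspaceT.
have [delta d0 unif] := uniform_continuity_on_compact cphiC cfE e0.
have [m m0 [md me]] : exists2 m : R, (0 < m)%R & (m <= delta /\ m <= e / 2)%R.
  by exists (Num.min delta (e / 2))%R; [rewrite lt_min d0|rewrite !ge_min !lexx orbT].
near=> n.
apply: (@le_lt_trans _ _ (mu_ext (P n) ([set w | (M' < `|@Zn n w|)%R] `|`
  [set w | ~ exists2 l : R, X n w = l%:E &
     (`|l - phi (@Zn n w)| <= m)%R]))).
  apply: le_mu_ext => w /= bad; apply: contrapT => /not_orP[/negP].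
  rewrite -leNgt => ZM /contrapT[l Xl lphi].
  move: bad; rewrite Xl; apply/negP; rewrite -leNgt; apply: unif.
    by exists (@Zn n w) => //; exact: ballC.
  exact: le_trans lphi md.
rewrite (le_lt_trans (mu_extU _ _ _))// (splitr e) EFinD lteD//.
  by near: n.
apply: (@lt_le_trans _ _ m%:E); last by rewrite lee_fin.
by near: n; exact: close.
Unshelve. all: by end_near. Qed.

End convergence_in_law.

End outer_expectation_lemmas.

(** * Measurability and equality of limit laws *)

Section gaussian_measurability.
Context {R : realType} {dT : measure_display} {T : measurableType dT}
  (Q : probability T R).

Lemma measurable_standard_gaussian k (Y : T -> symM R k) (psi : symM R k -> R) :
  standard_gaussian Q Y -> continuous psi ->
  measurable_fun setT (fun w => psi (Y w)).
Proof.
move=> [mG _ _] cpsi; have sb := @symM_euclidean R k.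
pose G (i : 'I_#|{: sym_index k}|) w := frob (Y w) (sym_basis R (enum_val i)).
rewrite (_ : (fun w => _) =
    fun w => (psi \o of_coords (e := @sym_basis_ord R k)) (\col_i G i w)).
  apply: measurable_continuous_coord => [a|i]; last exact: mG.
  by apply: continuous_comp; [exact: continuous_of_coords|exact: cpsi].
apply/funext => w /=; congr psi.
rewrite [LHS](dot_span sb); apply: eq_bigr => i _; rewrite mxE //.
Qed.

Lemma measurable_centered_gaussian d q (J : param R d q -> param R d q)
    (Z : T -> param R d q) (psi : param R d q -> R) :
  centered_gaussian Q J Z -> continuous psi ->
  measurable_fun setT (fun w => psi (Z w)).
Proof.
move=> [m [L [G [Llin [mG _ _] ZE _]]]] cpsi.
rewrite (_ : (fun w => _) = fun w => (psi \o L) (\col_i G i w)).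
  apply: measurable_continuous_coord => [a|i]; last exact: mG.
  apply: continuous_comp; last exact: cpsi.
  pose LL : {linear 'cV[R]_m -> param R d q} := HB.pack L
    (GRing.isLinear.Build _ _ _ _ L Llin).
  have -> : L = fun a => \sum_i a i 0 *: L (delta_mx i 0).
    apply/funext => b; rewrite -[L _]/(LL _) {1}[b]matrix_sum_delta linear_sum.
    by apply: eq_bigr => j _; rewrite big_ord1 linearZ.
  apply: continuous_sum => i b.
  exact: (cvgZr_tmp (@coord_continuous R m 1 i 0 b)).
by apply/funext => w; rewrite /= ZE.
Qed.

End gaussian_measurability.

Lemma eq_law_integral (R : realType) (d d' : measure_display) (T : measurableType d)
    (T' : measurableType d') (Q : probability T R) (Q' : probability T' R)
    (F : T -> R) (F' : T' -> R) (M : R) :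
  measurable_fun setT F -> measurable_fun setT F' ->
  (forall w, `|F w| <= M) -> (forall w, `|F' w| <= M) ->
  (forall B, measurable B -> Q (F @^-1` B) = Q' (F' @^-1` B)) ->
  (\int[Q]_w (F w)%:E = \int[Q']_w (F' w)%:E)%E.
Proof.
move=> mF mF' FM F'M law.
have iF : Q.-integrable setT (EFin \o F).
  apply: (le_integrable measurableT _ _ (finite_measure_integrable_cst Q M measurableT)).
    exact/measurable_EFinP.
  by move=> w _; rewrite /= lee_fin (le_trans (FM w))// ler_norm.
have iF' : Q'.-integrable setT (EFin \o F').
  apply: (le_integrable measurableT _ _ (finite_measure_integrable_cst Q' M measurableT)).
    exact/measurable_EFinP.
  by move=> w _; rewrite /= lee_fin (le_trans (F'M w))// ler_norm.
transitivity (\int[pushforward Q F]_x x%:E)%E.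
  by rewrite integral_pushforward.
transitivity (\int[pushforward Q' F']_x x%:E)%E; last first.
  by rewrite integral_pushforward.
by apply: eq_measure_integral => A mA _; exact: law.
Qed.

Lemma cvge0_near_lt (R : realType) (u : nat -> \bar R) (e : R) :
  (u n @[n --> \oo] --> 0)%E -> 0 < e -> \forall n \near \oo, (u n < e%:E)%E.
Proof.
move=> /fine_cvgP[ufin ucvg] e0.
by apply: filterS2 ufin (cvgr_lt _ ucvg _ e0) => n nfin nlt; rewrite -(fineK nfin) lte_fin.
Qed.

(** * Local expansion of the constrained likelihood *)

Section hausdorff_lemmas.
Context {R : realType} {V : normedModType R}.
Implicit Types A B : set V.

Lemma hausdorff_dist_sym A B : hausdorff_dist A B = hausdorff_dist B A.
Proof. by rewrite /hausdorff_dist maxC. Qed.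

Lemma hausdorff_dist_lt A B (delta : R) x :
  (hausdorff_dist A B < delta%:E)%E -> A x -> exists2 y, B y & `|x - y| < delta.
Proof.
move=> AB Ax; have : (esetdist x B < delta%:E)%E.
  apply: le_lt_trans AB; rewrite /hausdorff_dist le_max; apply/orP; left.
  by apply: ereal_sup_ubound; exists x.
by move=> /ereal_inf_lt[_ [y By <-]]; rewrite lte_fin => ?; exists y.
Qed.

End hausdorff_lemmas.

Lemma le_one_add_norms (R : realType) (a b x : R) : x <= a -> x <= 1 + `|a| + `|b|.
Proof.
move=> xa; rewrite (le_trans xa)// (le_trans (ler_norm a))//.
by rewrite addrAC lerDr addr_ge0.
Qed.

Lemma max_close_arith (R : realType) (v v2 s1 s1' s s2 m eta eps : R) :
  `|v - s1| <= eta -> s1 - s1' <= eta -> s1' <= m -> m - eta <= s ->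
  s - s2 <= eta -> `|v2 - s2| <= eta -> v2 <= v -> eta <= eps / 4 ->
  `|v - m| <= eps.
Proof.
rewrite !ler_norml => /andP[? ?] ? ? ? ? /andP[? ?] ? ?.
by apply/andP; split; lra.
Qed.

Section likelihood_expansion.
Context {R : realType} {d q : nat}.
Local Notation E := (param R d q).
Variables (J : E -> E).
Hypothesis Jpos : posdef_operator (@pdot R d q) J.

Local Notation sc := (score (dV := @pdot R d q) J).

Lemma param_normE (x : E) : `|x| = Num.sqrt (pdot x x).
Proof. by []. Qed.

Lemma score_lipschitz (Mz rho : R) : exists2 L : R, 0 < L &
  forall z h h' : E, `|z| <= Mz -> `|h| <= rho -> `|h'| <= rho ->
    sc z h - sc z h' <= L * `|h - h'|.
Proof.
have [N [e eb]] := param_euclidean (R := R) d q.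
have [Jlin Jsym _] := Jpos.
have [c c0 Jc] := linear_bounded eb param_normE Jlin.
have dotle := ler_dot_norm eb param_normE.
exists (1 + `|Mz| + c * `|rho|); first by rewrite ltr_wpDr ?mulr_ge0 ?(ltW c0)// ltr_wpDr.
move=> z h h' zM hr h'r.
have sub a b : pdot (a - b) z = pdot a z - pdot b z.
  by rewrite pdotDl -scaleN1r pdotZl mulN1r.
have subl a b u : pdot (a - b) u = pdot a u - pdot b u.
  by rewrite pdotDl -scaleN1r pdotZl mulN1r.
have -> : sc z h - sc z h' =
    pdot (h - h') z - (pdot (h - h') (J h) + pdot (h - h') (J h')) / 2.
  rewrite /score !subl.
  have -> : pdot h' (J h) = pdot h (J h') by rewrite -Jsym (dot_sym eb).
  by field.
have b1 : pdot (h - h') z <= `|Mz| * `|h - h'|.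
  rewrite (le_trans (ler_norm _))// (le_trans (dotle _ _))// mulrC ler_wpM2r//.
  by rewrite (le_trans zM)// ler_norm.
have b2 u : `|u| <= rho -> - (pdot (h - h') (J u)) <= c * `|rho| * `|h - h'|.
  move=> ur; rewrite (le_trans (ler_norm _))// normrN (le_trans (dotle _ _))//.
  rewrite mulrC ler_wpM2r// (le_trans (Jc _))// ler_pM2l//.
  by rewrite (le_trans ur)// ler_norm.
have := b2 _ hr; have := b2 _ h'r; have := normr_ge0 (h - h').
nra.
Qed.

(** Coercivity of the quadratic part bounds all near-maximisers: at a maximiser the
    score is at least its value 0 at the origin, and [- 1] leaves room for an
    approximation error. *)
Lemma score_maximiser_bound (Mz : R) : exists Mb : R,
  forall z h : E, `|z| <= Mz -> - 1 <= sc z h -> `|h| <= Mb.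
Proof.
have [N [e eb]] := param_euclidean (R := R) d q.
have [c c0 Jc] := posdef_coercive eb param_normE Jpos.
have dotle := ler_dot_norm eb param_normE.
exists (2 * c * `|Mz| + 2 * c + 1) => z h zM.
rewrite /score => sc1; rewrite leNgt; apply/negP => hbig.
have hz : pdot h z <= `|h| * `|Mz|.
  rewrite (le_trans (ler_norm _))// (le_trans (dotle _ _))// ler_wpM2l//.
  by rewrite (le_trans zM)// ler_norm.
have h2 := Jc h; have M0 := normr_ge0 Mz.
have hJ : pdot h (J h) <= 2 * (`|h| * `|Mz| + 1) by lra.
have : `|h| ^+ 2 <= c * (2 * (`|h| * `|Mz| + 1)).
  by rewrite (le_trans h2)// ler_pM2l.
have cM : 0 <= c * `|Mz| by rewrite mulr_ge0// ltW.
have h1 : 1 <= `|h| by rewrite ltW// (le_lt_trans _ hbig)// lerDr; lra.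
have : `|h| * (2 * c * `|Mz| + 2 * c + 1) < `|h| ^+ 2.
  by rewrite expr2 ltr_pM2l// (lt_le_trans _ h1).
have : c <= c * `|h| by rewrite ler_pMr.
nra.
Qed.

Section one_parameter_set.
Variables (k : nat) (U : 'M[R]_(q, k)).
Hypothesis UU : U^T *m U = 1%:M.
Variable K : set (symM R k).
Hypothesis K0 : K 0.

Local Notation ms := (max_score (dV := @pdot R d q) (dW := @frob R k) J
  (@active R d q k U) (reduced_cov J U) K).
Local Notation tangent := (nuisance_sum (d := d) [set H : symM R q | K (congr_sym U H)]).

Let symM_normE (x : symM R k) : `|x| = Num.sqrt (frob x x).
Proof. by []. Qed.

Lemma score_le_max z h : tangent h -> sc z h <= ms z.
Proof.
have [N [e eb]] := param_euclidean (R := R) d q.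
move=> Th; apply: (score_le eb (@symM_euclidean R k) symM_normE Jpos
  (active_linear U) (active_adjE U) (reduced_cov_posdef Jpos UU)
  (reduced_covE U Jpos)).
exact: Th.
Qed.

Lemma exists_score_near_max z (eps : R) : 0 < eps ->
  exists2 h, tangent h & ms z - eps <= sc z h.
Proof.
have [N [e eb]] := param_euclidean (R := R) d q.
move=> eps0; have [|h Kh scoreh] := score_approx eb (@symM_euclidean R k) symM_normE Jpos
  (active_linear U) (active_adjE U) (reduced_cov_posdef Jpos UU)
  (reduced_covE U Jpos) z (_ : K !=set0) eps0; first by exists 0.
by exists h.
Qed.

Lemma max_score_ge0 z : 0 <= ms z.
Proof.
have [N [e eb]] := param_euclidean (R := R) d q.
have := @score_le_max z 0; rewrite /score !(dot0l eb) mul0r subr0; apply.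
rewrite /nuisance_sum /=.
have -> : congr_sym U (0 : symM R q) = 0.
  by apply/val_inj; rewrite /= mulmx0 mul0mx.
exact: K0.
Qed.

(** The deterministic core. If [l - l0] is within [eta] of the score on a ball and
    the constraint set [A] is within [delta] of the tangent cone there, then the
    maximum of [l - l0] over [A] is within [eps] of the maximal score over the cone:
    move [hhat] to the cone for the upper bound, and a near-maximiser of the score
    to [A] for the lower bound. *)
Lemma expansion_max (Mz Mh eps : R) : 0 < eps -> exists rho delta eta : R,
  [/\ 0 < rho, 0 < delta, 0 < eta &
  forall (A : set E) (l : E -> \bar R) (l0 : R) (hhat z : E),
    `|z| <= Mz -> `|hhat| <= Mh ->
    A hhat -> (forall h, A h -> (l h <= l hhat)%E) ->
    (forall h, `|h| <= rho -> exists2 v : R, l h = (l0 + v)%:E & `|v - sc z h| <= eta) ->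
    (hausdorff_dist (A `&` [set h : E | (`|h| <= rho)%R])
       (tangent `&` [set h : E | (`|h| <= rho)%R]) < delta%:E)%E ->
    exists2 v : R, l hhat = (l0 + v)%:E & `|v - ms z| <= eps].
Proof.
move=> eps0.
have [Mb boundb] := score_maximiser_bound Mz.
(* the ball has to contain both hhat and the near-maximisers of the score *)
pose rho := 1 + `|Mb| + `|Mh|.
have rho0 : 0 < rho by rewrite ltr_wpDr// ltr_wpDr.
have [L L0 lip] := score_lipschitz Mz rho.
(* at most three errors of size eta add up; eta <= 1 is the slack allowed by Mb *)
pose eta := Num.min 1 (eps / 4).
have eta0 : 0 < eta by rewrite lt_min ltr01 divr_gt0.
have eta1 : eta <= 1 by rewrite ge_min lexx.
have eta4 : eta <= eps / 4 by rewrite ge_min lexx orbT.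
pose delta := eta / L.
have delta0 : 0 < delta by rewrite divr_gt0.
have Ldelta x : x < delta -> L * x <= eta.
  by move=> xd; rewrite mulrC -ler_pdivlMr// ltW.
exists rho, delta, eta; split=> // A l l0 hhat z zM hM Ahhat hmax expand haus.
have hr : `|hhat| <= rho.
  by rewrite /rho addrAC; exact: le_one_add_norms.
have [v lv vsc] := expand _ hr; exists v => //.
have [h' [Th' h'r] hh'] := hausdorff_dist_lt haus (conj Ahhat hr).
have up := lip z _ _ zM hr h'r; have Lup := Ldelta _ hh'.
have upm := score_le_max z Th'.
have [h Th scoreh] := exists_score_near_max z eta0.
have hb : `|h| <= rho.
  apply: le_one_add_norms; apply: (boundb z h zM); apply: le_trans scoreh.
  by rewrite lerBrDr (le_trans _ (max_score_ge0 z))// addrC subr_le0.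
rewrite hausdorff_dist_sym in haus.
have [h2 [Ah2 h2r] hh2] := hausdorff_dist_lt haus (conj Th hb).
have lo := lip z _ _ zM hb h2r; have Llo := Ldelta _ hh2.
have [v2 lv2 v2sc] := expand _ h2r.
have := hmax _ Ah2; rewrite lv lv2 lee_fin lerD2l => v2v.
apply: (max_close_arith vsc (le_trans up Lup) upm scoreh (le_trans lo Llo) v2sc v2v).
exact: eta4.
Qed.

End one_parameter_set.

End likelihood_expansion.

(** A finite bound on the expansion error forces both log-likelihoods to be
    finite: in extended arithmetic the difference of two infinite values is
    infinite. *)
Lemma ereal_expansion_real (R : realType) (x y : \bar R) (a b eta : R) :
  (`|x - y - a%:E + b%:E| <= eta%:E)%E ->
  exists u v : R, [/\ x = u%:E, y = v%:E & `|u - v - a + b| <= eta].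
Proof. by case: x => [u| |]; case: y => [v| |] //= ?; exists u, v. Qed.

Lemma rescaled_parameterK (R : realType) d q (theta0 theta : param R d q) n : (0 < n)%N ->
  theta0 + (Num.sqrt n%:R)^-1 *: (Num.sqrt n%:R *: (theta - theta0)) = theta.
Proof.
move=> n0; rewrite scalerA mulVf; first by rewrite scale1r addrC subrK.
by rewrite sqrtr_eq0 -ltNge ltr0n.
Qed.

Section profile_likelihood.
Context {R : realType} {d q : nat}.
Local Notation E := (param R d q).
Context {dX : nat -> measure_display} {X : forall n, measurableType (dX n)}
  (P : forall n, probability (X n) R) (p : forall n, E -> X n -> R)
  (theta0 : E) (Z : forall n, X n -> E) (J : E -> E).
Hypothesis Jpos : posdef_operator (@pdot R d q) J.
Hypothesis lan : LAN P p theta0 Z J.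
Hypothesis tightZ : forall eps : R, 0 < eps -> exists M : R,
  \forall n \near \oo, (mu_ext (P n) [set w | (M < `|Z w|)%R] < eps%:E)%E.
Context {k : nat} {U : 'M[R]_(q, k)} (UU : U^T *m U = 1%:M)
  (K : set (symM R k)) (K0 : K 0).
Variables (Theta : set E) (hhat : forall n, X n -> E).
Hypothesis hset : cvg_on_bounded_sets (rescaled_set theta0 Theta)
  (nuisance_sum [set H : symM R q | K (congr_sym U H)]).
Hypothesis hmax : asymptotic_maximiser P (rescaled_set theta0 Theta)
  (fun n => local_loglik (@p n) theta0 n) hhat.
Hypothesis hbdd : stochastically_bounded P hhat.

Local Notation ms := (max_score (dV := @pdot R d q) (dW := @frob R k) J
  (@active R d q k U) (reduced_cov J U) K).

(** Outside four sets of small outer probability ([Z] large, [hhat] large, failure of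
    the expansion on a compact set containing the relevant ball, failure of [hhat]
    to maximise), the hypotheses of [expansion_max] hold. *)
Lemma profile_loglik_close (eps : R) : 0 < eps -> \forall n \near \oo,
  (mu_ext (P n) [set w | ~ exists l0 v : R,
    [/\ loglik (@p n) theta0 w = l0%:E,
       ereal_sup [set loglik (@p n) theta w | theta in Theta] = (l0 + v)%:E
      & (`|v - ms (Z w)| <= eps)%R]] < eps%:E)%E.
Proof.
move=> eps0.
have [N [e eb]] := param_euclidean (R := R) d q.
have e4 : 0 < eps / 4 by rewrite divr_gt0.
(* boundedness comes with a weak inequality, hence eps / 8 instead of eps / 4 *)
have e8 : 0 < eps / 8 by rewrite divr_gt0.
have [Mz tz] := tightZ e4; have [Mh th] := hbdd e8.
have [rho [delta [eta [rho0 delta0 eta0 expansion]]]] :=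
  expansion_max Jpos UU K0 Mz Mh eps0.
have [C cC ballC] := ball_subset_compact eb (@param_normE R d q) rho.
have C0 : C !=set0 by exists 0; apply: ballC; rewrite normr0 ltW.
have lanC := cvge0_near_lt (lan cC C0 eta0) e4.
have maxC := cvge0_near_lt hmax e4.
have hausC : \forall n \near \oo, (hausdorff_dist
    (rescaled_set theta0 Theta n `&` [set h : E | (`|h| <= rho)%R])
    (nuisance_sum [set H : symM R q | K (congr_sym U H)] `&`
      [set h : E | (`|h| <= rho)%R]) < delta%:E)%E.
  by apply: cvge0_near_lt => //; exact: hset.
have n0C : \forall n \near \oo, (0 < n)%N by exact: nbhs_infty_gt.
apply: filterS (filterI (filterI lanC maxC) (filterI (filterI tz th) (filterI hausC n0C))).
move=> n [[lann maxn] [[tzn thn] [hausn n0]]].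
set bad1 := (X in mu_ext _ X) in lann; set bad2 := (X in mu_ext _ X) in maxn.
set bad3 := (X in mu_ext _ X) in tzn; set bad4 := (X in mu_ext _ X) in thn.
set bad := (X in mu_ext _ X).
have sub : bad `<=` (bad1 `|` bad2) `|` (bad3 `|` bad4).
  move=> w badw; apply: contrapT => /not_orP[/not_orP[/negP + /contrapT[Ahat maxhat]]].
  rewrite -leNgt => lanw /not_orP[/negP + /negP]; rewrite -!leNgt => Zw hatw.
  apply: badw.
  have expand h : `|h| <= rho -> exists u v : R,
      [/\ local_loglik (@p n) theta0 n h w = u%:E, loglik (@p n) theta0 w = v%:E
        & `|u - v - pdot h (Z w) + pdot h (J h) / 2| <= eta].
    move=> hr; apply: ereal_expansion_real.
    apply: (le_trans _ lanw); apply: (le_trans _ (lee_abs _)).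
    by apply: ereal_sup_ubound; exists h => //; exact: ballC.
  have [|_ [l0 [_ ll0 _]]] := expand 0; first by rewrite normr0 ltW.
  have [h hr|v lv vms] := expansion (rescaled_set theta0 Theta n)
    (fun h => local_loglik (@p n) theta0 n h w) l0 (hhat w) (Z w) Zw hatw Ahat maxhat _ hausn.
    have [u [v [lu lv uv]]] := expand _ hr.
    have vl0 : v = l0 by apply: EFin_inj; rewrite -lv ll0.
    exists (u - l0); first by rewrite lu addrC subrK.
    by rewrite /score -vl0 opprB addrA addrAC.
  exists l0, v; split=> //; rewrite -lv; apply/eqP; rewrite eq_le; apply/andP; split.
    apply: ge_ereal_sup => _ [theta Ttheta <-].
    rewrite -(rescaled_parameterK theta0 theta n0).
    by apply: maxhat; rewrite /rescaled_set /= rescaled_parameterK.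
  by apply: ereal_sup_ubound; exists (theta0 + (Num.sqrt n%:R)^-1 *: hhat w).
apply: (le_lt_trans (le_mu_ext (P n) sub)).
apply: (le_lt_trans (mu_extU _ _ _)).
rewrite (_ : eps = (eps / 4 + eps / 4) + (eps / 4 + eps / 4)); last by field.
rewrite EFinD lteD//.
  by apply: (le_lt_trans (mu_extU _ _ _)); rewrite EFinD lteD.
apply: (le_lt_trans (mu_extU _ _ _)); rewrite EFinD lteD//.
by apply: (le_lt_trans thn); rewrite lte_fin ltr_pM2l// ltf_pV2 ?posrE// ltr_nat.
Qed.

End profile_likelihood.

(** * Independence of the basis of the kernel *)

Section kernel_basis_independence.
Context {R : realType} {q k : nat} {Sigma : symM R q}.

Lemma orthonormal_kernel_basis_change (U U' : 'M[R]_(q, k)) :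
  orthonormal_kernel_basis U Sigma -> orthonormal_kernel_basis U' Sigma ->
  exists V : 'M[R]_k, U' = U *m V.
Proof.
move=> [UU kerU] [UU' kerU']; exists (U^T *m U').
have colE' j : col j U' = col j (U *m (U^T *m U')).
  have [y yE] : exists y : 'cV[R]_k, col j U' = U *m y.
    by apply/kerU/kerU'; exists (delta_mx j 0); rewrite colE.
  by rewrite [RHS]colE -!mulmxA -[U' *m _]colE yE (mulmxA U^T) UU mul1mx.
apply/matrixP => i j; have := congr1 (fun v : 'cV[R]_q => v i 0) (colE' j).
by rewrite mxE => ->; rewrite mxE.
Qed.

Lemma psd_congr (U : 'M[R]_(q, k)) (V : 'M[R]_k) H :
  psd (congr_sym U H) -> psd (congr_sym (U *m V) H).
Proof.
move=> psdH x; have := psdH (V *m x).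
by rewrite /= !trmx_mul !mulmxA.
Qed.

Lemma T1cone_basis (U U' : 'M[R]_(q, k)) :
  orthonormal_kernel_basis U Sigma -> orthonormal_kernel_basis U' Sigma ->
  T1cone U `<=` T1cone U'.
Proof.
move=> bU bU' H; have [V ->] := orthonormal_kernel_basis_change bU bU'.
exact: psd_congr.
Qed.

Lemma T0cone_basis (U U' : 'M[R]_(q, k)) m :
  orthonormal_kernel_basis U Sigma -> orthonormal_kernel_basis U' Sigma ->
  T0cone U m `<=` T0cone U' m.
Proof.
move=> bU bU' H [psdH rkH]; have [V ->] := orthonormal_kernel_basis_change bU bU'.
split; first exact: psd_congr.
have -> : (congr_sym (U *m V) H : 'M[R]_k) = V^T *m (congr_sym U H : 'M[R]_k) *m V.
  by rewrite /= !trmx_mul !mulmxA.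
by rewrite (leq_trans (mxrankM_maxl _ _))// (leq_trans (mxrankM_maxr _ _)).
Qed.

End kernel_basis_independence.

Section limit_statistic.
Context {R : realType} {d q k : nat}.
Variables (J : param R d q -> param R d q).
Hypothesis Jpos : posdef_operator (@pdot R d q) J.

Lemma psd_cone0 : @psd_cone R k 0.
Proof. by move=> x; rewrite mulmx0 mul0mx mxE. Qed.

Lemma psd_rank_le0 m : psd_rank_le m (0 : symM R k).
Proof. by split; [exact: psd_cone0|rewrite mxrank0]. Qed.

(** The terms [dot z (J^-1 z)] cancel: the limit statistic at the whitened score is
    twice the difference of the two maximal scores. *)
Lemma Delta_whiteE (U : 'M[R]_(q, k)) m z :
  Delta J U m (white J U z) =
  2 * (max_score (dV := @pdot R d q) (dW := @frob R k) J (@active R d q k U)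
         (reduced_cov J U) (@psd_cone R k) z -
       max_score (dV := @pdot R d q) (dW := @frob R k) J (@active R d q k U)
         (reduced_cov J U) (@psd_rank_le R k m) z).
Proof. by rewrite max_score_diff. Qed.

Lemma continuous_Delta (U : 'M[R]_(q, k)) m : continuous (Delta J U m).
Proof.
apply: continuous_sqr_setdist_sub.
  by eexists; exists 0; [exact: psd_rank_le0|].
by eexists; exists 0; [exact: psd_cone0|].
Qed.

Lemma continuous_white (U : 'M[R]_(q, k)) : U^T *m U = 1%:M ->
  continuous (white J U).
Proof.
move=> UU; have [N [e eb]] := param_euclidean (R := R) d q.
apply: (continuous_euclidean_linear eb (@param_normE R d q)).
apply: (whiten_linear eb (@symM_euclidean R k) Jpos (active_linear U)).
exact: reduced_cov_posdef.
Qed.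

Lemma max_score_basis (U U' : 'M[R]_(q, k)) (K : set (symM R k)) z :
  U^T *m U = 1%:M -> U'^T *m U' = 1%:M -> K 0 ->
  (forall H : symM R q, K (congr_sym U H) -> K (congr_sym U' H)) ->
  max_score (dV := @pdot R d q) (dW := @frob R k) J (@active R d q k U)
     (reduced_cov J U) K z <=
  max_score (dV := @pdot R d q) (dW := @frob R k) J (@active R d q k U')
     (reduced_cov J U') K z.
Proof.
move=> UU UU' K0 KU; apply/ler_addgt0Pr => eps eps0.
have [h Kh scoreh] := exists_score_near_max Jpos UU K0 z eps0.
rewrite -lerBlDr (le_trans scoreh)//; apply: score_le_max => //.
exact: KU.
Qed.

(** The maximal scores depend on the basis only through the tangent cones, and
    these are the same for all bases of the kernel. Arguing through the scores avoids
    comparing the square roots that the two bases lead to. *)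
Lemma Delta_white_basis (Sigma : symM R q) (U U' : 'M[R]_(q, k)) m z :
  orthonormal_kernel_basis U Sigma -> orthonormal_kernel_basis U' Sigma ->
  Delta J U m (white J U z) = Delta J U' m (white J U' z).
Proof.
move=> bU bU'; have [UU _] := bU; have [UU' _] := bU'.
have ms_eq (K : set (symM R k)) : K 0 ->
    (forall H : symM R q, K (congr_sym U H) -> K (congr_sym U' H)) ->
    (forall H : symM R q, K (congr_sym U' H) -> K (congr_sym U H)) ->
    max_score (dV := @pdot R d q) (dW := @frob R k) J (@active R d q k U)
      (reduced_cov J U) K z =
    max_score (dV := @pdot R d q) (dW := @frob R k) J (@active R d q k U')
      (reduced_cov J U') K z.
  move=> K0 KU KU'; apply/le_anti/andP; split.
    exact: (max_score_basis z UU UU' K0 KU).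
  exact: (max_score_basis z UU' UU K0 KU').
have psdE := ms_eq _ psd_cone0 (T1cone_basis bU bU') (T1cone_basis bU' bU).
have rankE := ms_eq _ (psd_rank_le0 m) (@T0cone_basis _ _ _ _ _ _ m bU bU')
  (@T0cone_basis _ _ _ _ _ _ m bU' bU).
by rewrite (Delta_whiteE U) (Delta_whiteE U') psdE rankE.
Qed.

End limit_statistic.

(** * The likelihood-ratio statistic *)

Lemma ratio_real (R : realType) (s1 s0 : \bar R) (l0 l0' v1 v0 m1 m0 e D : R) :
  s1 = (l0 + v1)%:E -> s0 = (l0' + v0)%:E -> l0 = l0' ->
  `|v1 - m1| <= e / 4 -> `|v0 - m0| <= e / 4 -> D = 2 * (m1 - m0) ->
  exists2 l : R, (2%:E * (s1 - s0))%E = l%:E & `|l - D| <= e.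
Proof.
move=> -> -> -> v1m v0m ->; exists (2 * (v1 - v0)).
  by rewrite -EFinB -EFinM; congr EFin; ring.
move: v1m v0m; rewrite !ler_norml => /andP[? ?] /andP[? ?].
by apply/andP; split; lra.
Qed.

Section likelihood_ratio.
Context {R : realType} {d q : nat}.
Local Notation E := (param R d q).
Context {dX : nat -> measure_display} {X : forall n, measurableType (dX n)}
  (P : forall n, probability (X n) R) (p : forall n, E -> X n -> R)
  (theta0 : E) (Zn : forall n, X n -> E) (J : E -> E).
Hypothesis Jpos : posdef_operator (@pdot R d q) J.
Hypothesis lan : LAN P p theta0 Zn J.
Context {dZ : measure_display} {TZ : measurableType dZ} (QZ : probability TZ R)
  (Z : TZ -> E).
Hypothesis gaussZ : centered_gaussian QZ J Z.
Hypothesis ZnZ : cvg_in_law P Zn QZ Z.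
Context {k : nat} {U : 'M[R]_(q, k)} (UU : U^T *m U = 1%:M) (m : nat).
Variables (Theta0 Theta1 : set E) (hhat0 hhat1 : forall n, X n -> E).
Hypotheses
  (hset0 : cvg_on_bounded_sets (rescaled_set theta0 Theta0)
             (nuisance_sum (T0cone U m)))
  (hset1 : cvg_on_bounded_sets (rescaled_set theta0 Theta1)
             (nuisance_sum (T1cone U)))
  (hmax0 : asymptotic_maximiser P (rescaled_set theta0 Theta0)
             (fun n => local_loglik (@p n) theta0 n) hhat0)
  (hmax1 : asymptotic_maximiser P (rescaled_set theta0 Theta1)
             (fun n => local_loglik (@p n) theta0 n) hhat1)
  (hbdd0 : stochastically_bounded P hhat0)
  (hbdd1 : stochastically_bounded P hhat1).

Let measurable_normZ : measurable_fun setT (fun w => `|Z w|).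
Proof. exact: (measurable_centered_gaussian gaussZ (@norm_continuous _ _)). Qed.

(** The common value [loglik theta0] cancels in the difference of the suprema. *)
Lemma LR_stat_close (eps : R) : 0 < eps -> \forall n \near \oo,
  (mu_ext (P n) [set w | ~ exists2 l : R,
     LR_stat (@p n) Theta0 Theta1 w = l%:E &
     (`|l - Delta J U m (white J U (Zn w))| <= eps)%R] < eps%:E)%E.
Proof.
move=> eps0; have e4 : 0 < eps / 4 by rewrite divr_gt0.
have tight := tight_of_cvg_in_law ZnZ measurable_normZ.
have close1 := profile_loglik_close Jpos lan tight UU (@psd_cone0 R k) hset1 hmax1 hbdd1 e4.
have close0 := profile_loglik_close Jpos lan tight UU (@psd_rank_le0 R k m) hset0 hmax0 hbdd0 e4.
apply: filterS2 close1 close0 => n bad1 bad0.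
apply: (@le_lt_trans _ _ (eps / 4 + eps / 4)%:E); last first.
  by rewrite lte_fin -mulrDl ltr_pdivrMr// -mulr2n mulr_natr ltr_pMn2l.
set A1 := (S in mu_ext _ S) in bad1; set A0 := (S in mu_ext _ S) in bad0.
set A := (S in mu_ext _ S).
have sub : A `<=` A1 `|` A0; last first.
  apply: ltW; apply: (le_lt_trans (le_mu_ext (P n) sub)).
  by apply: (le_lt_trans (mu_extU _ _ _)); rewrite EFinD lteD.
move=> w badw; apply: contrapT => /not_orP[/contrapT[l1 [v1 [ll1 sup1 v1m]]]].
move=> /contrapT[l0 [v0 [ll0 sup0 v0m]]]; apply: badw.
apply: (ratio_real sup1 sup0 _ v1m v0m (Delta_whiteE _ _ _ _)).
by apply: EFin_inj; rewrite -ll1 -ll0.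
Qed.

Lemma LR_stat_cvg_in_law (dY : measure_display) (TY : measurableType dY)
    (Q : probability TY R) (Y : TY -> symM R k) : standard_gaussian Q Y ->
  cvg_in_law P (fun n => LR_stat (@p n) Theta0 Theta1)
    Q (fun w => (Delta J U m (Y w))%:E).
Proof.
move=> gaussY f cf fbd; have [M fM] := fbd.
have [N [e eb]] := param_euclidean (R := R) d q.
have cpsi : continuous (fun y : symM R k => f (Delta J U m y)%:E).
  move=> y; apply: (@continuous_comp _ _ _ (Delta J U m) (f \o EFin)).
    exact: continuous_Delta.
  by apply: continuous_comp; [apply: cvg_EFin; [exact: nearW|exact: cvg_id]|exact: cf].
have cwhite := continuous_white Jpos UU.
rewrite unlock -[X in _ --> X](_ : \int[QZ]_w (f (Delta J U m (white J U (Z w)))%:E)%:E = _)%E.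
  apply: (cvg_in_law_of_close ZnZ measurable_normZ
    (phi := fun z => Delta J U m (white J U z)) _ _ LR_stat_close cf fbd).
    by move=> M'; exact: (ball_subset_compact eb (@param_normE R d q) M').
  by move=> z; apply: continuous_comp; [exact: cwhite|exact: continuous_Delta].
apply: (@eq_law_integral R _ _ _ _ QZ Q
  (fun w => f (Delta J U m (white J U (Z w)))%:E)
  (fun w => f (Delta J U m (Y w))%:E) M).
- apply: (measurable_centered_gaussian (psi := fun z => f (Delta J U m (white J U z))%:E) gaussZ).
  move=> z; apply: (@continuous_comp _ _ _ (white J U) (fun y => f (Delta J U m y)%:E)).
    exact: cwhite.
  exact: cpsi.
- exact: (measurable_standard_gaussian gaussY cpsi).
- by move=> w; exact: fM.
- by move=> w; exact: fM.
- move=> B mB; exact/esym/(white_gaussian_law Jpos UU gaussY gaussZ cpsi mB).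
Qed.

End likelihood_ratio.

Theorem theorem3p3 (R : realType) (dpsi q r s : nat) (hrq : (r < q)%N)
  (dX : nat -> measure_display) (X : forall n, measurableType (dX n))
  (Pr : forall n, param R dpsi q -> probability (X n) R)
  (p : forall n, param R dpsi q -> X n -> R)
  (Theta0 Theta1 : set (param R dpsi q)) (theta0 : param R dpsi q)
  (N : set (param R dpsi q)) (hN : open N) (hNtheta0 : N theta0)
  (hlik : forall n, is_likelihood (Pr n) (p n) (Theta1 `|` N))
  (hTheta01 : Theta0 `<=` Theta1)
  (hTheta1 : forall theta, Theta1 theta -> psd_cone theta.2)
  (hTheta0 : forall theta, Theta0 theta -> psd_rank_le r theta.2)
  (htheta0 : Theta0 theta0)
  (hrank : \rank (theta0.2 : 'M[R]_q) = s) (hsr : (s <= r)%N)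
  (U : 'M[R]_(q, q - s)) (hU : orthonormal_kernel_basis U theta0.2)
  (J : param R dpsi q -> param R dpsi q) (hJ : posdef_operator (@pdot R dpsi q) J)
  (Zn : forall n, X n -> param R dpsi q) (hZn : forall n, random_element (Zn n))
  (hLAN : LAN (fun n => Pr n theta0) p theta0 Zn J)
  (dZ : measure_display) (TZ : measurableType dZ) (QZ : probability TZ R)
  (Z : TZ -> param R dpsi q) (hZ : centered_gaussian QZ J Z)
  (hZnZ : cvg_in_law (fun n => Pr n theta0) Zn QZ Z)
  (hset0 : cvg_on_bounded_sets (rescaled_set theta0 Theta0)
             (nuisance_sum (T0cone U (r - s))))
  (hset1 : cvg_on_bounded_sets (rescaled_set theta0 Theta1)
             (nuisance_sum (T1cone U)))
  (hhat0 hhat1 : forall n, X n -> param R dpsi q)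
  (hmax0 : asymptotic_maximiser (fun n => Pr n theta0)
             (rescaled_set theta0 Theta0)
             (fun n => local_loglik (p n) theta0 n) hhat0)
  (hmax1 : asymptotic_maximiser (fun n => Pr n theta0)
             (rescaled_set theta0 Theta1)
             (fun n => local_loglik (p n) theta0 n) hhat1)
  (hbdd0 : stochastically_bounded (fun n => Pr n theta0) hhat0)
  (hbdd1 : stochastically_bounded (fun n => Pr n theta0) hhat1) :
  (forall (dY : measure_display) (TY : measurableType dY)
      (Q : probability TY R) (Y : TY -> symM R (q - s)),
      standard_gaussian Q Y ->
      cvg_in_law (fun n => Pr n theta0)
        (fun n => LR_stat (p n) Theta0 Theta1)
        Q (fun w => (Delta J U (r - s) (Y w))%:E))
  /\
  (forall U' : 'M[R]_(q, q - s), orthonormal_kernel_basis U' theta0.2 ->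
    forall (dY : measure_display) (TY : measurableType dY)
      (Q : probability TY R) (Y : TY -> symM R (q - s))
      (dY' : measure_display) (TY' : measurableType dY')
      (Q' : probability TY' R) (Y' : TY' -> symM R (q - s)),
      standard_gaussian Q Y -> standard_gaussian Q' Y' ->
      forall B : set R, measurable B ->
        Q [set w | B (Delta J U (r - s) (Y w))] =
        Q' [set w | B (Delta J U' (r - s) (Y' w))]).
Proof.
have [UU _] := hU; split=> [dY TY Q Y|U' hU' dY TY Q Y dY' TY' Q' Y' gY gY' B mB].
  exact: (LR_stat_cvg_in_law hJ hLAN hZ hZnZ UU hset0 hset1 hmax0 hmax1 hbdd0 hbdd1).
have [UU' _] := hU'.
rewrite (white_gaussian_law hJ UU gY hZ (@continuous_Delta _ _ _ _ J U (r - s)) mB).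
rewrite (white_gaussian_law hJ UU' gY' hZ (@continuous_Delta _ _ _ _ J U' (r - s)) mB).
(* both laws are the law of one random variable, a function of Z *)
have DE w := Delta_white_basis hJ (r - s) (Z w) hU hU'.
apply: (congr1 QZ); apply/funext => w; exact: (congr1 B (DE w)).
Qed.
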